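(* Let $V$ be a finite set of $n\ge 3$ cities, let $G=(V,E)$ be the complete graph on $V$, and let $c:E\to\mathbb{R}_{\ge 0}$ be symmetric edge costs. Let $x$ be a fractional 2-matching (F2M) for $c$ whose support has no cut edge. Then there exists a graphical 2-matching (G2M) on $V$ whose cost is at most $\frac{10}{9}\sum_{e\in E}c(e)x(e)$.
   Context: A fractional 2-matching (F2M) is an optimal solution $x$ of the LP $\min \sum_{e\in E}c(e)x(e)$ subject to $\sum_{e\in\delta(i)}x(e)=2$ for all $i\in V$ and $0\le x(e)\le 1$ for all $e\in E$, where $\delta(i)$ is the set of edges incident to $i$; as in the paper, F2Ms are taken to have the standard (Balinski) structure of extreme-point solutions: every connected component of the support graph $\{e: x(e)>0\}$ is either a cycle on at least three vertices with $x(e)=1$ on all its edges (an integer component), or a fractional component consisting of odd cycles whose edges have $x(e)=\frac12$ (''cycle edges'') joined by paths whose edges have $x(e)=1$ (''path edges''). A cut edge is a path edge whose removal disconnects its fractional component of the support graph. A graphical 2-matching (G2M) is a multiset of edges of $G$ in which every vertex of $V$ has degree 2 or 4, every edge appears 0, 1 or 2 times, and every connected component has at least three vertices; its cost is the sum of $c(e)$ over the multiset (counted with multiplicity). *)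

(* Defs.v *)
From mathcomp Require Import all_boot all_order all_algebra.
From mathcomp Require Import reals.
Set Implicit Arguments.
Unset Strict Implicit.
Unset Printing Implicit Defensive.
Import Order.TTheory GRing.Theory Num.Theory.
Local Open Scope ring_scope.

(* Edges are unordered pairs, encoded as two-element subsets of V. A function
   on edges is a function on {set V}, and only its values on [edges V] matter. *)
Definition edges (V : finType) : {set {set V}} := [set e : {set V} | #|e| == 2%N].

Definition delta (V : finType) (v : V) : {set {set V}} :=
  [set e in edges V | v \in e].

Definition cost (R : realType) (V : finType) (c x : {set V} -> R) : R :=
  \sum_(e in edges V) c e * x e.

Section Graphs.
Variable V : finType.
Implicit Types (A : {set {set V}}) (C : {set V}) (p : seq V).

Definition adj A : rel V := [rel u v | [set u; v] \in A].

Definition component A (v : V) : {set V} := [set w | connect (adj A) v w].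

Definition components A : {set {set V}} := [set component A v | v : V].

Definition connected_on A C : Prop :=
  {in C &, forall u v, connect (adj A) u v}.

Definition edges_in A C : {set {set V}} := [set e in A | e \subset C].

Definition simple_cycle p : bool := (3 <= size p)%N && uniq p.

Definition cycle_edges p : {set {set V}} := [set [set v; next p v] | v in p].

(* (u, q, w) stands for the path u, q_1, ..., q_k, w with inner vertices q. *)
Definition link : Type := (V * seq V * V)%type.
Definition link_inner (l : link) : seq V := l.1.2.
Definition link_vertices (l : link) : seq V := l.1.1 :: rcons l.1.2 l.2.
Definition link_edges (l : link) : {set {set V}} :=
  [set:: [seq [set uv.1; uv.2]
         | uv <- zip (link_vertices l) (behead (link_vertices l))]].

End Graphs.

Section FractionalTwoMatching.
Variables (R : realType) (V : finType).
Implicit Types (c x y : {set V} -> R) (C : {set V}).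

Definition feasible x : Prop :=
  (forall v : V, \sum_(e in delta v) x e = 2) /\
  (forall e, e \in edges V -> 0 <= x e <= 1).

Definition optimal c x : Prop :=
  feasible x /\ (forall y, feasible y -> cost c x <= cost c y).

Definition support x : {set {set V}} := [set e in edges V | 0 < x e].

Definition integer_component x C : Prop :=
  exists p : seq V,
    [/\ simple_cycle p, C = [set v in p],
        edges_in (support x) C = cycle_edges p
      & forall e, e \in cycle_edges p -> x e = 1].

(* [cs] lists the odd cycles and [ls] the paths joining them; the cycles are
   vertex-disjoint, and the paths meet the cycles and each other at most in
   their end vertices, which lie on cycles. *)
Definition fractional_component x C : Prop :=
  exists (cs : seq (seq V)) (ls : seq (link V)),
    let inner := flatten [seq link_inner l | l <- ls] in
    [/\ forall p, p \in cs -> simple_cycle p /\ odd (size p),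
        forall l, l \in ls -> [/\ uniq (link_vertices l),
                                  l.1.1 \in flatten cs & l.2 \in flatten cs],
        uniq (flatten cs ++ inner) /\ C = [set v in flatten cs ++ inner],
        edges_in (support x) C =
          (\bigcup_(p <- cs) cycle_edges p) :|: (\bigcup_(l <- ls) link_edges l)
      & (forall p e, p \in cs -> e \in cycle_edges p -> x e = 1 / 2) /\
        (forall l e, l \in ls -> e \in link_edges l -> x e = 1)].

Definition F2M c x : Prop :=
  optimal c x /\
  (forall C, C \in components (support x) ->
     integer_component x C \/ fractional_component x C).

(* In a fractional component the path edges are exactly the support edges of
   value 1, the cycle edges having value 1/2. *)
Definition path_edge x C (e : {set V}) : Prop :=
  [/\ C \in components (support x), fractional_component x C,
      e \in edges_in (support x) C & x e = 1].

Definition cut_edge x (e : {set V}) : Prop :=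
  exists C, path_edge x C e /\ ~ connected_on (support x :\ e) C.

End FractionalTwoMatching.

(* m e is the multiplicity of e. *)
Definition G2M (V : finType) (m : {set V} -> nat) : Prop :=
  [/\ forall e, (0 < m e)%N -> e \in edges V,
      forall e, (m e <= 2)%N,
      forall v : V, (\sum_(e in delta v) m e)%N = 2%N \/
                    (\sum_(e in delta v) m e)%N = 4%N
    & forall C, C \in components [set e : {set V} | (0 < m e)%N] -> (3 <= #|C|)%N].

(* Main.v *)
Require Import Defs.
From mathcomp Require Import all_boot all_order all_algebra.
From mathcomp Require Import reals.
From mathcomp Require Import zify ring lra.
Set Implicit Arguments.
Unset Strict Implicit.
Unset Printing Implicit Defensive.
Import Order.TTheory GRing.Theory Num.Theory.
Local Open Scope ring_scope.

(* Every vertex meets either two edges of value 1, or two edges of value 1/2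
   (cycle edges) and one edge of value 1, which starts a path leading to another
   such "half" vertex.  In the graphical 2-matching each cycle edge is used zero
   or one times, and each path either once, or according to one of three
   patterns: for a residue r, the edges whose index is r mod 3 are dropped and
   the others doubled.  The three patterns together cost four times the path.
   An end of the path that loses both of its cycle edges needs the first two
   path edges on its side doubled, which singles out one pattern.  For paths of
   length k with k mod 3 <> 2 (type I) the two ends single out different
   patterns, and for k mod 3 = 2 (type II) the same one.

   The admissible choices are the perfect matchings of an auxiliary graph: each
   half vertex u becomes a centre and two darts, one per cycle edge at u, and
   the centres and darts of the two ends of a path are joined so that a matching
   encodes the use of the path.  A dart matched to its opposite dart means that
   the cycle edge is dropped.  Fractional values (4/9 on the dropped edges) give
   expected cost 5/9 on a cycle edge and 10/9 on a path.  That these values lie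
   in the perfect matching polytope is a computation with odd cuts, in which a
   cut edge of the support would be the only obstruction; the perfect matching
   is then given by Edmonds' theorem. *)

(** * The perfect matching polytope *)

(** The constants come from the target. Dropping a cycle edge with weight 4/9 keeps it with weight
    5/9 = 10/9 * 1/2. Every centre and every dart then has two edges of value 4/9, so only 1/9 is
    left for the edges that join the two ends of a path. That is just enough: compared with using
    the path once, each of the three patterns of a type I path enters with coefficient 1/9, and
    since together they cost four paths, the excess is (4 - 3)/9 of the path. For type II the
    cheaper of the two patterns that serve no end takes both shares. The odd cuts leave no slack
    either. A path with exactly one end whose two darts are separated contributes at least 10/18,
    and parity then forces a crossing cycle edge, worth 8/18: together exactly 1. A path that meets
    the odd set oddly without separating the darts of an end may contribute only 6/18; three of them
    suffice, and a single one falls short only if nothing else crosses, which makes it a bridge. *)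

Section PerfectMatching.
Variables (R : realFieldType) (W : finType).
Implicit Types (y c : W -> W -> R) (A S U : {set W}) (s : {ffun W -> W}).

Definition cut y A S : R := \sum_(i in S) \sum_(j in A :\: S) y i j.

(** Edmonds' description of the perfect matching polytope of the complete graph on A, a point being
    a symmetric weight on ordered pairs. *)
Definition frac_matching A y : Prop :=
  [/\ forall i j, y i j = y j i, forall i j, 0 <= y i j,
      forall i, i \in A -> \sum_(j in A) y i j = 1
    & forall S, S \subset A -> odd #|S| -> 1 <= cut y A S].

Definition matching A y s : bool :=
  [forall i in A, [&& s i \in A, s (s i) == i & 0 < y i (s i)]].

Lemma matchingP A y s :
  reflect (forall i, i \in A -> [/\ s i \in A, s (s i) = i & 0 < y i (s i)])
          (matching A y s).
Proof.
apply: (iffP forall_inP) => H i iA.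
  by have /and3P[? /eqP ? ?] := H i iA; split.
by have [-> -> ->] := H i iA; rewrite eqxx.
Qed.

(** Both sums run over ordered pairs, so an edge costs [c i j + c j i]. As [c] need not be
    symmetric, a cost can be put on one direction only. *)
Definition edmonds_at A : Prop := forall y c, frac_matching A y ->
  exists s, matching A y s /\
    \sum_(i in A) c i (s i) <= \sum_(i in A) \sum_(j in A) c i j * y i j.

(** * Odd cuts: contraction and gluing at cuts of value 1 *)

Lemma cut_setD y A S : (forall i j, y i j = y j i) -> S \subset A ->
  cut y A (A :\: S) = cut y A S.
Proof.
move=> ysym SA; rewrite /cut exchange_big /=.
rewrite setDDr setDv set0U (setIidPr SA).
by apply: eq_bigr => i _; apply: eq_bigr.
Qed.

(** The degree equation at i includes the loop, while the cut of [[set i]] reaches 1 without it. *)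
Lemma frac_matching_diag A y i : frac_matching A y -> i \in A -> y i i = 0.
Proof.
move=> [ys y0 yd yc] iA.
have := yc [set i]; rewrite sub1set iA cards1 /cut big_set1 => /(_ isT isT).
have := yd _ iA; rewrite (big_setD1 i) //= => <-.
by move: (y0 i i) => H1 H2; apply/eqP; rewrite eq_le H1 andbT; lra.
Qed.

Lemma frac_matching_even A y : frac_matching A y -> ~~ odd #|A|.
Proof.
move=> [ys y0 yd yc]; apply/negP => oA.
have := yc A (subxx _) oA; rewrite /cut setDv big1 ?ler10 // => i _.
by rewrite big_set0.
Qed.

(** The complement of U is shrunk to [x0]. Any vertex outside U can play this part, so the
    contracted graph lives on the same type. *)
Lemma contract_frac_matching A y U x0 : frac_matching A y -> U \subset A ->
  odd #|U| -> cut y A U = 1 -> x0 \notin U ->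
  let Y i := \sum_(j in A :\: U) y i j in
  frac_matching (x0 |: U)
    (fun i j => if i == x0 then (if j == x0 then 0 else Y j)
                else if j == x0 then Y i else y i j).
Proof.
move=> [ys y0 yd yc] UA oU tU x0U Y.
have Y0 i : 0 <= Y i by apply: sumr_ge0.
set y' := fun i j => _.
have ys' i j : y' i j = y' j i.
  by rewrite /y'; case: (i == x0); case: (j == x0).
have Un i : i \in U -> (i == x0) = false.
  by move=> iU; apply/eqP => e; rewrite -e iU in x0U.
have yU i j : i \in U -> j \in U -> y' i j = y i j.
  by move=> iU jU; rewrite /y' !Un.
have yx i : i \in U -> y' i x0 = Y i by move=> iU; rewrite /y' Un // eqxx.
have key S : S \subset x0 |: U -> odd #|S| -> x0 \notin S -> 1 <= cut y' (x0 |: U) S.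
  move=> SA oS x0S.
  have SU : S \subset U.
    apply/subsetP => i iS; have := subsetP SA i iS.
    by rewrite !inE => /orP[/eqP e|//]; rewrite -e iS in x0S.
  rewrite (_ : cut _ _ _ = cut y A S); first by apply: yc => //; apply: subset_trans SU UA.
  apply: eq_bigr => i iS; have iU := subsetP SU i iS.
  rewrite (big_setD1 x0) /=; last by rewrite !inE eqxx x0S.
  rewrite yx // [RHS](big_setID U) /= addrC; congr (_ + _).
    rewrite (_ : (A :\: S) :&: U = U :\: S).
      rewrite (_ : _ :\ x0 = U :\: S).
        by apply: eq_bigr => j; rewrite inE => /andP[_ jU]; rewrite yU.
      apply/setP => j; rewrite !inE; case: (j =P x0) => [->|_] //=.
      by rewrite (negPf x0U) andbF.
    apply/setP => j; rewrite !inE; case jU : (j \in U); rewrite ?andbF //.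
    by rewrite (subsetP UA _ jU) !andbT.
  rewrite /Y; apply: eq_bigl => j; rewrite !inE.
  case jU: (j \in U) => //=; case jS : (j \in S) => //=.
  by rewrite (subsetP SU _ jS) in jU.
split=> //.
- by move=> i j; rewrite /y'; do 2 ?case: eqP.
- move=> i; rewrite !inE => /orP[/eqP->|iU].
    rewrite big_setU1 //= {1}/y' !eqxx add0r -[RHS]tU /cut.
    by apply: eq_bigr => j jU; rewrite ys' yx.
  rewrite big_setU1 //= yx // -(yd i (subsetP UA i iU)) [RHS](big_setID U) /=.
  rewrite (setIidPr UA) addrC; congr (_ + _).
  by apply: eq_bigr => j jU; rewrite yU.
(* [x0 |: U] has even size, so an odd set containing [x0] has an odd complement, which avoids [x0]
   and has the same cut. *)
- move=> S SA oS; case x0S : (x0 \in S); last by apply: key; rewrite ?x0S.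
  rewrite -cut_setD //; apply: key.
  + exact: subsetDl.
  + have := cardsID S (x0 |: U); rewrite (setIidPr SA) cardsU1 x0U /=.
    lia.
  + by rewrite !inE x0S.
Qed.

(* F u is the least cost of a matching of U \ u.  Giving the edge from u to the
   contracted vertex the cost - F u makes all these matchings cost at least 0,
   which is the announced bound on the mean of F. *)
Lemma tight_cut_side A y U c : frac_matching A y -> U \subset A -> odd #|U| ->
  cut y A U = 1 -> (#|U| + 1 < #|A|)%N ->
  (forall A', (#|A'| < #|A|)%N -> edmonds_at A') ->
  let Y i := \sum_(j in A :\: U) y i j in
  exists (F : W -> R) (s : W -> {ffun W -> W}),
    (forall u, u \in U -> 0 < Y u -> matching (U :\ u) y (s u) /\
        F u = \sum_(i in U :\ u) c i (s u i)) /\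
    \sum_(u in U) F u * Y u <= \sum_(i in U) \sum_(j in U) c i j * y i j.
Proof.
move=> fy UA oU tU cUA IH Y.
have [x0 x0A x0U] : exists2 x0, x0 \in A & x0 \notin U.
  apply/subsetPn/negP => /subset_leq_card; lia.
pose A' := x0 |: U.
pose y' i j := if i == x0 then (if j == x0 then 0 else Y j)
               else if j == x0 then Y i else y i j.
have fy' : frac_matching A' y' := contract_frac_matching fy UA oU tU x0U.
have cA' : (#|A'| < #|A|)%N by rewrite /A' cardsU1 x0U; lia.
have Un i : i \in U -> (i == x0) = false.
  by move=> iU; apply/eqP => e; rewrite -e iU in x0U.
pose cst u (t : {ffun W -> W}) := \sum_(i in U :\ u) c i (t i).
(* With cost -1 on the single ordered pair (x0, u) the fractional cost is [- Y u < 0], so a matching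
   of no larger cost has to use that pair. *)
have exu u : u \in U -> 0 < Y u -> exists t, matching A' y' t && (t x0 == u).
  move=> uU Yu.
  have [t [mt]] := IH _ cA' y' (fun i j => - ((i == x0) && (j == u))%:R) fy'.
  rewrite !(big_setU1 _ x0U) /= big1 => [|i iU]; last by rewrite Un ?oppr0.
  rewrite [X in _ <= _ + X]big1 => [|i iU]; last first.
    by rewrite big1 // => j _; rewrite Un // oppr0 mul0r.
  rewrite !addr0 !eqxx /= {1}/y' !eqxx mulr0 add0r => H.
  exists t; rewrite mt /=; apply/negPn/negP => /negPf tu; move: H; rewrite tu oppr0.
  rewrite (bigD1 u) //= eqxx big1 ?addr0.
    by rewrite /y' eqxx Un //= mulN1r; move: Yu; clear; lra.
  by move=> i /andP[_ /negPf->]; rewrite oppr0 mul0r.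
have exm u : exists t, u \in U -> 0 < Y u -> [/\ matching A' y' t, t x0 = u &
     forall t', matching A' y' t' -> t' x0 = u -> cst u t <= cst u t'].
  case uU : (u \in U); last by exists (finfun id).
  case Yu : (0 < Y u); last by exists (finfun id).
  have [t0 t0P] := exu u uU Yu.
  pose Q (t : {ffun W -> W}) := matching A' y' t && (t x0 == u).
  case: (@arg_minP _ _ _ t0 Q (cst u) t0P) => t /andP[mt /eqP tx] tm.
  by exists t => _ _; split=> // t' mt' t'x; apply: tm; rewrite /Q mt' t'x eqxx.
have [s sP] := fin_all_exists exm.
exists (fun u => cst u (s u)), s; split.
  move=> u uU Yu; have [/matchingP mt tx _] := sP u uU Yu; split=> //.
  have xA : x0 \in A' by rewrite !inE eqxx.
  have su : s u u = x0 by rewrite -{2}tx; case: (mt x0 xA).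
  apply/matchingP => i; rewrite !inE => /andP[iu iU].
  have iA : i \in A' by rewrite !inE iU orbT.
  have [siA ssi yi] := mt i iA.
  have six : s u i != x0.
    by apply: contraNneq iu => e; rewrite -ssi e tx.
  move: siA; rewrite !inE (negPf six) /= => siU; split=> //.
    rewrite siU andbT; apply: contraFneq (Un i iU) => e.
    by rewrite -ssi e su.
  by move: yi; rewrite /y' Un // (negPf six).
have [t [mt]] := IH _ cA' y' (fun i j => if i == x0 then 0 else
   if j == x0 then - cst i (s i) else c i j) fy'.
have xA : x0 \in A' by rewrite !inE eqxx.
have [tA ttx yx] := matchingP _ _ _ mt x0 xA.
have txx : t x0 != x0.
  apply/negP => /eqP e; move: yx; rewrite e /y' eqxx ltxx //.
have tU' : t x0 \in U by move: tA; rewrite !inE (negPf txx).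
have Yt : 0 < Y (t x0) by move: yx; rewrite /y' eqxx (negPf txx).
have [_ _ tmin] := sP _ tU' Yt.
have {}tmin := tmin t mt erefl; set u := t x0 in tU' Yt txx tmin *.
rewrite big_setU1 //= eqxx add0r (big_setD1 u) //= (negPf txx) ttx eqxx.
rewrite [X in _ + X <= _](_ : _ = cst u t); last first.
  apply: eq_bigr => i; rewrite !inE => /andP[iu iU]; rewrite Un //.
  case: eqP => // e; case/eqP: iu.
  have iA : i \in A' by rewrite !inE iU orbT.
  by have [_ <- _] := matchingP _ _ _ mt i iA; rewrite e.
rewrite [X in _ <= X](_ : _ = \sum_(i in U) \sum_(j in U) c i j * y i j -
   \sum_(i in U) cst i (s i) * Y i); first lra.
rewrite big_setU1 //= big1 ?add0r => [|i _]; last by rewrite eqxx mul0r.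
rewrite -sumrB; apply: eq_bigr => i iU; rewrite big_setU1 //= !eqxx Un //.
rewrite /y' Un // eqxx addrC mulNr; congr (_ - _).
by apply: eq_bigr => j jU; rewrite Un.
Qed.

(** Since the cut has value 1, y is a probability distribution on the pairs (u, w) across it. The
    mean of [F u + G w + (c u w + c w u)] is at most the fractional cost, so some crossing pair of
    positive weight does as well, and the matchings of the two sides without u and w are glued along
    it. *)
Lemma edmonds_tight_cut A y U c : frac_matching A y -> U \subset A -> odd #|U| ->
  cut y A U = 1 -> (1 < #|U|)%N -> (#|U| + 1 < #|A|)%N ->
  (forall A', (#|A'| < #|A|)%N -> edmonds_at A') ->
  exists s, matching A y s /\
    \sum_(i in A) c i (s i) <= \sum_(i in A) \sum_(j in A) c i j * y i j.
Proof.
move=> fy UA oU tU cU cUA IH; have [ys y0 yd yc] := fy.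
have eA := frac_matching_even fy.
pose V := A :\: U.
have AV : A :\: V = U by rewrite setDDr setDv set0U (setIidPr UA).
have cV : #|V| = (#|A| - #|U|)%N by rewrite cardsD (setIidPr UA).
have [F [s [sP Fle]]] := tight_cut_side c fy UA oU tU cUA IH.
have [||||G [r [rP Gle]]] := tight_cut_side (U := V) c fy _ _ _ _ IH.
- exact: subsetDl.
- by rewrite cV; lia.
- by rewrite cut_setD.
- by rewrite cV; lia.
move: sP Fle rP Gle; rewrite AV -/V /=.
set Y := fun i => \sum_(j in V) y i j; set Z := fun i => \sum_(j in U) y i j.
move=> sP Fle rP Gle.
have splitA (f : W -> R) : \sum_(i in A) f i = \sum_(i in U) f i + \sum_(i in V) f i.
  by rewrite (big_setID U) /= (setIidPr UA).
have [u uU [w wV [yuw le]]] : exists2 u, u \in U & exists2 w, w \in V & 0 < y u w /\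
  F u + G w + (c u w + c w u) <= \sum_(i in A) \sum_(j in A) c i j * y i j.
  set T := \sum_(i in A) _.
  case: (boolP [exists u in U, [exists w in V, (0 < y u w) &&
    (F u + G w + (c u w + c w u) <= T)]]).
    by move=> /exists_inP[u uU /exists_inP[w wV /andP[? ?]]]; exists u => //; exists w.
  rewrite negb_exists_in => /forall_inP H.
  have lt u w : u \in U -> w \in V -> 0 < y u w ->
     T * y u w < (F u + G w + (c u w + c w u)) * y u w.
    move=> uU wV yuw; have := H u uU; rewrite negb_exists_in => /forall_inP/(_ w wV).
    by rewrite yuw /= -ltNge => ?; rewrite ltr_pM2r.
  have le u w : u \in U -> w \in V ->
     T * y u w <= (F u + G w + (c u w + c w u)) * y u w.
    move=> uU wV; have := y0 u w; rewrite le_eqVlt => /orP[/eqP<-|/(lt u w uU wV)/ltW//].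
    by rewrite !mulr0.
  have [u0 u0U [w0 w0V yuw0]] : exists2 u, u \in U & exists2 w, w \in V & 0 < y u w.
    case: (boolP [exists u in U, [exists w in V, 0 < y u w]]).
      by move=> /exists_inP[u uU /exists_inP[w wV ?]]; exists u => //; exists w.
    rewrite negb_exists_in => /forall_inP H'.
    have : cut y A U = 0.
      rewrite /cut big1 // => i iU; rewrite big1 // => j jV.
      have := H' i iU; rewrite negb_exists_in => /forall_inP/(_ j jV).
      by rewrite -leNgt => yle; apply/eqP; rewrite eq_le yle y0.
    by rewrite tU => /eqP; rewrite oner_eq0.
  have tot : T = \sum_(i in U) \sum_(j in V) T * y i j.
    under eq_bigr do rewrite -mulr_sumr.
    by rewrite -mulr_sumr -[X in T * X]/(cut y A U) tU mulr1.
  suff : \sum_(i in U) \sum_(j in V) T * y i j < T by rewrite -tot ltxx.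
  apply: (@lt_le_trans _ _ (\sum_(i in U) \sum_(j in V)
     (F i + G j + (c i j + c j i)) * y i j)).
    rewrite (bigD1 u0) //= [X in _ < X](bigD1 u0) //=; apply: ltr_leD; last first.
      by apply: ler_sum => i /andP[iU _]; apply: ler_sum => j jV; apply: le.
    rewrite (bigD1 w0) //= [X in _ < X](bigD1 w0) //=; apply: ltr_leD; first exact: lt.
    by apply: ler_sum => j /andP[jV _]; apply: le.
  rewrite /T splitA.
  have -> : \sum_(i in U) \sum_(j in A) c i j * y i j =
     \sum_(i in U) \sum_(j in U) c i j * y i j + \sum_(i in U) \sum_(j in V) c i j * y i j.
    by rewrite -big_split; apply: eq_bigr => i _; rewrite splitA.
  have -> : \sum_(i in V) \sum_(j in A) c i j * y i j =
     \sum_(i in V) \sum_(j in V) c i j * y i j + \sum_(i in U) \sum_(j in V) c j i * y i j.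
    rewrite [X in _ = _ + X]exchange_big -big_split; apply: eq_bigr => i _.
    by rewrite splitA addrC; congr (_ + _); apply: eq_bigr => j _; rewrite ys.
  have -> : \sum_(i in U) \sum_(j in V) (F i + G j + (c i j + c j i)) * y i j =
     \sum_(i in U) F i * Y i + \sum_(j in V) G j * Z j +
     (\sum_(i in U) \sum_(j in V) c i j * y i j + \sum_(i in U) \sum_(j in V) c j i * y i j).
    have -> : \sum_(j in V) G j * Z j = \sum_(i in U) \sum_(j in V) G j * y i j.
      rewrite exchange_big /=; apply: eq_bigr => j _; rewrite /Z mulr_sumr.
      by apply: eq_bigr => i _; rewrite ys.
    rewrite -!big_split /=; apply: eq_bigr => i _; rewrite /Y mulr_sumr -!big_split /=.
    by apply: eq_bigr => j _; ring.
  lra.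
have [UV wA] : w \notin U /\ w \in A by move: wV; rewrite inE => /andP[].
have uV : u \notin V by rewrite inE uU.
have Yu : 0 < Y u.
  by rewrite /Y (bigD1 w) //=; apply: ltr_wpDr => //; apply: sumr_ge0.
have Zw : 0 < Z w.
  by rewrite /Z (bigD1 u) //=; apply: ltr_wpDr; [apply: sumr_ge0 | rewrite ys].
have [/matchingP ms Fu] := sP u uU Yu.
have [/matchingP mr Gw] := rP w wV Zw.
exists [ffun v => if v == u then w else if v == w then u else
                  if v \in U then s u v else r w v].
have uA := subsetP UA u uU.
have uw : (w == u) = false by apply/eqP => e; rewrite e uU in UV.
split.
  apply/matchingP => i iA; rewrite !ffunE.
  case: (i =P u) => [->|/eqP iu]; first by rewrite eqxx uw.
  case: (i =P w) => [->|/eqP iw]; first by rewrite eqxx ys.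
  case: (boolP (i \in U)) => [iU|iU].
    have [] := ms i; rewrite ?inE ?iu //= => /andP[su sU] ssi yi.
    rewrite (negPf su) sU ssi (subsetP UA _ sU); split=> //.
    by case: eqP => // e; rewrite -e sU in UV.
  have iV : i \in V by rewrite inE iU.
  have [] := mr i; rewrite ?inE ?iw ?iU //= => /and3P[su sU sA] ssi yi.
  rewrite (negPf su) (negPf sU) ssi sA; split=> //.
  by case: eqP => // e; rewrite e uU in sU.
apply: le_trans le; rewrite splitA (big_setD1 u) // (big_setD1 w wV) /= !ffunE eqxx uw eqxx.
rewrite (_ : \sum_(i in U :\ u) _ = F u); last first.
  rewrite Fu; apply: eq_bigr => i; rewrite !inE ffunE => /andP[/negPf-> iU].
  by rewrite iU; case: eqP => // e; rewrite -e iU in UV.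
rewrite (_ : \sum_(i in V :\ w) _ = G w); last first.
  rewrite Gw; apply: eq_bigr => i; rewrite !inE ffunE => /and3P[/negPf-> iU iA].
  by rewrite (negPf iU); case: eqP => // e; rewrite e uU in iU.
lra.
Qed.

Lemma matching_sub A y y' s : (forall i j, 0 < y' i j -> 0 < y i j) ->
  matching A y' s -> matching A y s.
Proof.
move=> H /matchingP m; apply/matchingP => i /m[? ? ?]; split=> //; exact: H.
Qed.

Lemma cut_deg A y S : (forall i, i \in A -> \sum_(j in A) y i j = 1) -> S \subset A ->
  cut y A S = #|S|%:R - \sum_(i in S) \sum_(j in S) y i j.
Proof.
move=> yd SA; rewrite -sum1_card natr_sum -sumrB; apply: eq_bigr => i iS.
rewrite -(yd i (subsetP SA i iS)) [in RHS](big_setID S) /= (setIidPr SA).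
by rewrite addrAC subrr add0r.
Qed.

(** The degree equations leave nothing for other edges at i and j, so removing both changes neither
    the degrees nor the cuts of the rest. *)
Lemma edmonds_delete_pair A y c i j : frac_matching A y -> i \in A -> j \in A ->
  y i j = 1 -> (forall A', (#|A'| < #|A|)%N -> edmonds_at A') ->
  exists s, matching A y s /\
    \sum_(i in A) c i (s i) <= \sum_(i in A) \sum_(j in A) c i j * y i j.
Proof.
move=> fy iA jA yij IH; have [ys y0 yd yc] := fy.
have ij : j != i.
  apply/eqP => e; move: yij; rewrite e (frac_matching_diag fy iA) => /eqP.
  by rewrite eq_sym oner_eq0.
have only k l m : k \in A -> l \in A -> y k l = 1 -> m \in A -> m != l -> y k m = 0.
  move=> kA lA ykl mA ml.
  have := yd k kA; rewrite (big_setD1 l) //= (big_setD1 m) /=; last by rewrite !inE ml.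
  have : 0 <= \sum_(p in (A :\ l) :\ m) y k p by apply: sumr_ge0.
  by move: (y0 k m) => H1 H2 H3; apply/eqP; rewrite eq_le H1 andbT; lra.
have yi k : k \in A -> k != j -> y i k = 0 by move=> kA kj; apply: only yij _ kj.
have yj k : k \in A -> k != i -> y j k = 0.
  by move=> kA ki; apply: only ki => //; rewrite ys.
pose A' := (A :\ i) :\ j.
have cA : (#|A'| < #|A|)%N.
  have := cardsD1 i A; have := cardsD1 j (A :\ i).
  by rewrite /A' !inE ij iA jA; lia.
have bigA (f : W -> R) : \sum_(k in A) f k = f i + f j + \sum_(k in A') f k.
  rewrite (big_setD1 i iA) (big_setD1 j) /=; first by rewrite addrA.
  by rewrite !inE ij.
have A'P k : k \in A' -> [/\ k \in A, k != i & k != j].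
  by rewrite !inE => /and3P[].
have [||s [/matchingP ms le]] := IH A' _ y c; first by [].
  split=> //.
    move=> k /A'P[kA ki kj]; rewrite -(yd k kA) bigA.
    by rewrite (ys k i) (ys k j) yi ?yj // !add0r.
  move=> S SA oS; have SA' : S \subset A.
    by apply: subset_trans SA _; apply/subsetP => k /A'P[].
  apply: le_trans (yc S SA' oS) _; apply: ler_sum => k kS.
  have [kA ki kj] := A'P k (subsetP SA k kS).
  have iS : i \notin S by apply/negP => /(subsetP SA)/A'P[_]; rewrite eqxx.
  have jS : j \notin S by apply/negP => /(subsetP SA)/A'P[_ _]; rewrite eqxx.
  rewrite (big_setD1 i) /=; last by rewrite inE iS.
  rewrite (big_setD1 j) /=; last by rewrite !inE ij jS.
  rewrite (ys k i) (ys k j) yi ?yj // !add0r le_eqVlt; apply/orP; left; apply/eqP.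
  by apply: eq_bigl => l; rewrite !inE; do !case: (_ \in _); do !case: eqP.
exists [ffun k => if k == i then j else if k == j then i else s k]; split.
  apply/matchingP => k kA; rewrite !ffunE.
  case: (k =P i) => [->|/eqP ki]; first by rewrite (negPf ij) eqxx yij ltr01.
  case: (k =P j) => [->|/eqP kj]; first by rewrite eqxx ys yij ltr01.
  have [|/A'P[skA /negPf-> /negPf->] ssk ysk] := ms k; first by rewrite !inE kj ki.
  by rewrite ssk.
rewrite !bigA !ffunE eqxx (negPf ij) eqxx.
rewrite !(frac_matching_diag fy) // (ys j i) !yij !mulr0 !mulr1 add0r addr0.
rewrite [\sum_(k in A') c i k * _]big1; last first.
  by move=> k /A'P[kA ki kj]; rewrite yi // mulr0.
rewrite [\sum_(k in A') c j k * _]big1; last first.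
  by move=> k /A'P[kA ki kj]; rewrite yj // mulr0.
rewrite !addr0 lerD2l; apply: le_trans (le_trans le _).
  rewrite le_eqVlt; apply/orP; left; apply/eqP; apply: eq_bigr => k /A'P[_ /negPf ki /negPf kj].
  by rewrite ffunE ki kj.
apply: ler_sum => k /A'P[kA ki kj].
by rewrite bigA (ys k i) (ys k j) yi ?yj // !mulr0 !add0r.
Qed.

Lemma matching4 y c (a b d e : W) : (forall i j, y i j = y j i) ->
  uniq [:: a; b; d; e] -> 0 < y a b -> 0 < y d e ->
  exists s, matching [set i in [:: a; b; d; e]] y s /\
    \sum_(i in [set i in [:: a; b; d; e]]) c i (s i) = c a b + c b a + c d e + c e d.
Proof.
move=> ys un yab yde.
have big4 (f : W -> R) : \sum_(i in [set i in [:: a; b; d; e]]) f i = f a + f b + f d + f e.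
  rewrite (eq_bigl (fun i => i \in [:: a; b; d; e])); last by move=> i; rewrite !inE.
  by rewrite -big_uniq //= !big_cons big_nil addr0 !addrA.
move: un; rewrite /= !inE !negb_or => /and4P[/and3P[ab ad ae] /andP[bd be] de _].
exists [ffun i => if i == a then b else if i == b then a else if i == d then e else d].
have [ba da ea] : [/\ b != a, d != a & e != a] by split; rewrite eq_sym.
have [db eb ed] : [/\ d != b, e != b & e != d] by split; rewrite eq_sym.
split; last first.
  rewrite big4 !ffunE !eqxx (negPf ba) (negPf da) (negPf ea) (negPf db) (negPf eb).
  by rewrite (negPf ed).
apply/matchingP => i; rewrite !inE !ffunE => /or4P[] /eqP->;
  rewrite ?eqxx ?(negPf ba) ?(negPf da) ?(negPf ea) ?(negPf db) ?(negPf eb)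
    ?(negPf ed) ?eqxx ?(negPf ba) ?(negPf da) ?(negPf ea) ?(negPf db) ?(negPf eb)
    ?(negPf ed) ?eqxx ?orbT; split=> //; by rewrite ys.
Qed.

Lemma weighted_mean3 (m1 m2 m3 p q r : R) : 0 <= p -> 0 <= q -> 0 <= r -> p + q + r = 1 ->
  let T := m1 * p + m2 * q + m3 * r in
  (0 < p /\ m1 <= T) \/ ((0 < q /\ m2 <= T) \/ (0 < r /\ m3 <= T)).
Proof.
move=> p0 q0 r0 pqr T.
have cases m k : 0 <= k -> (0 < k /\ m <= T) \/ (T * k <= m * k /\ (0 < k -> T * k < m * k)).
  rewrite le_eqVlt => /orP[/eqP<-|k0]; first by right; rewrite !mulr0 ltxx.
  case: (leP m T) => h; [by left | right].
  by split=> [|_]; rewrite ?ler_pM2r ?ltr_pM2r ?(ltW h).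
have [?|[l1 s1]] := cases m1 _ p0; first by left.
have [?|[l2 s2]] := cases m2 _ q0; first by right; left.
have [?|[l3 s3]] := cases m3 _ r0; first by right; right.
have T1 : T = T * p + T * q + T * r by rewrite -!mulrDr pqr mulr1.
have T2 : T = m1 * p + m2 * q + m3 * r by [].
move: l1 l2 l3 s1 s2 s3 T1 T2; clearbody T.
move: (T * p) (T * q) (T * r) (m1 * p) (m2 * q) (m3 * r) => a b d a' b' d' l1 l2 l3 s1 s2 s3 T1 T2.
have [h1|h1] := ltP 0 p; first by have := s1 h1; lra.
have [h2|h2] := ltP 0 q; first by have := s2 h2; lra.
have [h3|h3] := ltP 0 r; first by have := s3 h3; lra.
lra.
Qed.

(** The degree equations make opposite edges equal in value, so y is a convex combination of the
    three perfect matchings on four vertices. The case stands apart because the cut of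
    [degree2_tight] would have a single vertex on its other side, and contraction would not shrink
    the graph. *)
Lemma edmonds4 A y c : frac_matching A y -> #|A| = 4%N ->
  exists s, matching A y s /\
    \sum_(i in A) c i (s i) <= \sum_(i in A) \sum_(j in A) c i j * y i j.
Proof.
move=> fy cA; have [ys y0 yd yc] := fy.
have [a [b [d [e [un eA]]]]] : exists a b d e,
   uniq [:: a; b; d; e] /\ A = [set i in [:: a; b; d; e]].
  have := enum_uniq A; have := set_enum A; move: cA; rewrite cardE.
  case: (enum A) => [|a [|b [|d [|e [|? ?]]]]] //= _ <- un.
  by exists a, b, d, e; split.
have big4 (f : W -> R) : \sum_(i in A) f i = f a + f b + f d + f e.
  rewrite eA (eq_bigl (fun i => i \in [:: a; b; d; e])); last by move=> i; rewrite !inE.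
  by rewrite -big_uniq //= !big_cons big_nil addr0 !addrA.
have [aA bA dA eeA] : [/\ a \in A, b \in A, d \in A & e \in A].
  by rewrite eA !inE !eqxx !orbT.
have row i : i \in A -> y i a + y i b + y i d + y i e = 1.
  by move=> iA; rewrite -(yd i iA) big4.
have [yaa ybb ydd yee] : [/\ y a a = 0, y b b = 0, y d d = 0 & y e e = 0].
  by rewrite !(frac_matching_diag fy).
have [Ha Hb Hd He] := And4 (row a aA) (row b bA) (row d dA) (row e eeA).
rewrite (ys b a) ybb in Hb; rewrite (ys d a) (ys d b) ydd in Hd.
rewrite (ys e a) (ys e b) (ys e d) yee in He; rewrite yaa in Ha.
move: (y0 a b) (y0 a d) (y0 a e) => p q r.
have pqr : y a b + y a d + y a e = 1 by lra.
have yde : y d e = y a b by lra.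
have ybe : y b e = y a d by lra.
have ybd : y b d = y a e by lra.
have -> : \sum_(i in A) \sum_(j in A) c i j * y i j =
    (c a b + c b a + c d e + c e d) * y a b + (c a d + c d a + c b e + c e b) * y a d
    + (c a e + c e a + c b d + c d b) * y a e.
  rewrite !big4 !(frac_matching_diag fy) // (ys b a) (ys d a) (ys d b) (ys e a) (ys e b) (ys e d).
  rewrite yde ybe ybd; ring.
have [[y1 l1]|[[y1 l1]|[y1 l1]]] := @weighted_mean3 (c a b + c b a + c d e + c e d)
  (c a d + c d a + c b e + c e b) (c a e + c e a + c b d + c d b) _ _ _ p q r pqr.
- have [|s [ms cs]] := matching4 c ys un y1; first by rewrite yde.
  by exists s; rewrite eA ms cs.
- have [||s [ms cs]] := @matching4 y c a d b e ys _ y1; last 1 first.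
  + exists s; rewrite (_ : A = [set i in [:: a; d; b; e]]) ?ms ?cs //.
    rewrite eA; apply/setP => i; rewrite !inE.
    by case: (i == a); case: (i == b); case: (i == d); case: (i == e).
  + move: un; rewrite /= !inE !negb_or => /and4P[/and3P[-> -> ->] /andP[bd be] de _].
    by rewrite (eq_sym d b) bd be de.
  + by rewrite ybe.
- have [||s [ms cs]] := @matching4 y c a e b d ys _ y1; last 1 first.
  + exists s; rewrite (_ : A = [set i in [:: a; e; b; d]]) ?ms ?cs //.
    rewrite eA; apply/setP => i; rewrite !inE.
    by case: (i == a); case: (i == b); case: (i == d); case: (i == e).
  + move: un; rewrite /= !inE !negb_or => /and4P[/and3P[-> -> ->] /andP[bd be] de _].
    by rewrite (eq_sym e b) (eq_sym e d) bd be de.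
  + by rewrite ybd.
Qed.

(** For i and its two neighbours j, k the cut is 3 - 2 (y i j + y i k + y j k) = 1 - 2 y j k, hence
    at most 1; the odd set inequality gives equality. *)
Lemma degree2_tight A y i : frac_matching A y -> i \in A ->
  #|[set j in A | 0 < y i j]| = 2%N ->
  exists U : {set W}, [/\ U \subset A, #|U| = 3%N & cut y A U = 1].
Proof.
move=> fy iA /eqP/cards2P[j [k [jk eN]]]; have [ys y0 yd yc] := fy.
have inN l : l \in [set j; k] -> l \in A /\ 0 < y i l by rewrite -eN inE => /andP[].
have [jA yj] : j \in A /\ 0 < y i j by apply: inN; rewrite !inE eqxx.
have [kA yk] : k \in A /\ 0 < y i k by apply: inN; rewrite !inE eqxx orbT.
have yii := frac_matching_diag fy iA.
have ij : i != j by apply/eqP => e; move: yj; rewrite -e yii ltxx.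
have ik : i != k by apply/eqP => e; move: yk; rewrite -e yii ltxx.
have sumi : y i j + y i k = 1.
  rewrite -(yd i iA) (big_setID [set j; k]) /=.
  rewrite (setIidPr _); last by apply/subsetP => l /inN[].
  rewrite big_setU1 ?inE //= big_set1 [X in _ = _ + X]big1 ?addr0 // => l.
  rewrite -eN !inE negb_and => /andP[/orP[/negPf->//|]]; rewrite -leNgt => h _.
  by apply/eqP; rewrite eq_le h y0.
have SA : [set i; j; k] \subset A.
  by apply/subsetP => l; rewrite !inE => /orP[/orP[]|] /eqP->.
have big3 (f : W -> R) : \sum_(l in [set i; j; k]) f l = f i + f j + f k.
  rewrite -setUA big_setU1; last by rewrite !inE negb_or ij.
  by rewrite big_setU1 ?inE //= big_set1 addrA.
have cS : #|[set i; j; k]| = 3%N by rewrite -setUA !cardsU1 !inE negb_or ij ik jk cards1.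
exists [set i; j; k]; split=> //.
have := yc _ SA; rewrite cS => /(_ isT).
rewrite cut_deg // cS !big3 !(frac_matching_diag fy) // (ys j i) (ys k i) (ys k j).
move: (y0 j k) => h1 h2; lra.
Qed.

(** * Moving along a circulation, and Edmonds' theorem *)

Lemma circulation A y : frac_matching A y -> A != set0 ->
  (forall i, i \in A -> (2 < #|[set j in A | (0 < y i j)%R]|)%N) ->
  exists z : W -> W -> R, [/\ forall i j, z i j = z j i,
    forall i j, z i j != 0 -> [/\ i \in A, j \in A & 0 < y i j],
    forall i, i \in A -> \sum_(j in A) z i j = 0
  & exists i j, z i j != 0].
Proof.
move=> fy A0 deg3; have [ys y0 yd yc] := fy.
pose lt (i j : W) := (enum_rank i < enum_rank j)%N.
pose E := [set p : W * W | [&& p.1 \in A, p.2 \in A, 0 < y p.1 p.2 & lt p.1 p.2]].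
(* Counting ends of edges gives 3|A| <= 2|E|. With more edges than vertices, the incidence matrix
   with one row per edge has a nonzero left kernel vector, which is the circulation. *)
have cE : (#|A| < #|E|)%N.
  suff : (3 * #|A| <= 2 * #|E|)%N by have := A0; rewrite -card_gt0; lia.
  have -> : (3 * #|A| = \sum_(i in A) 3)%N by rewrite sum_nat_const mulnC.
  apply: (@leq_trans (\sum_(i in A) #|[set j in A | (0 < y i j)%R]|)%N).
    by apply: leq_sum => i /deg3.
  have -> : (\sum_(i in A) #|[set j in A | (0 < y i j)%R]| =
     \sum_(i in A) \sum_(j in A) (0 < y i j)%R)%N.
    apply: eq_bigr => i _; rewrite -sum1_card big_mkcond [RHS]big_mkcond.
    by apply: eq_bigr => j _; rewrite inE; case: (j \in A); case: (0 < _).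
  have -> : (\sum_(i in A) \sum_(j in A) (0 < y i j)%R =
     \sum_(i in A) \sum_(j in A) ((0 < y i j)%R && lt i j)
     + \sum_(i in A) \sum_(j in A) ((0 < y i j)%R && lt i j))%N.
    rewrite [X in (_ = _ + X)%N]exchange_big -big_split; apply: eq_bigr => i iA.
    rewrite -big_split; apply: eq_bigr => j jA /=; rewrite (ys j i) /lt.
    case: (ltngtP (enum_rank i) (enum_rank j)) => [||/val_inj/enum_rank_inj e].
    - by rewrite andbT andbF addn0.
    - by rewrite andbT andbF add0n.
    - by rewrite e (frac_matching_diag fy jA) ltxx.
  rewrite addnn -mul2n leq_mul2l /= -sum1_card pair_big /= big_mkcond.
  rewrite [X in (_ <= X)%N]big_mkcond; apply: leq_sum => -[i j] _ /=.
  by rewrite inE /=; case: (i \in A); case: (j \in A); case: (0 < _); case: (lt i j).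
pose M := \matrix_(k < #|E|, l < #|A|)
  (((enum_val k).1 == enum_val l)%:R + ((enum_val k).2 == enum_val l)%:R : R).
have : kermx M != 0.
  by rewrite -mxrank_eq0 mxrank_ker; have := rank_leq_col M; lia.
rewrite -nz_row_eq0; set v := nz_row (kermx M) => v0.
have vM : v *m M = 0 by apply/sub_kermxP/nz_row_sub.
pose f (p : W * W) : R := \sum_(k < #|E|) v 0 k * (enum_val k == p)%:R.
have fE p : f p != 0 -> p \in E.
  apply: contraR => pE; rewrite /f big1 // => k _; case: eqP => [e|_]; rewrite ?mulr0 //.
  by rewrite -e enum_valP in pE.
have fk k : f (enum_val k) = v 0 k.
  rewrite /f (bigD1 k) //= eqxx mulr1 big1 ?addr0 // => l /negPf lk.
  by case: eqP => [/enum_val_inj e|]; rewrite ?mulr0 // -e eqxx in lk *.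
exists (fun i j => f (i, j) + f (j, i)); split.
- by move=> i j; rewrite addrC.
- move=> i j; case: (eqVneq (f (i, j)) 0) => [->|/fE]; last by rewrite inE => /and4P[].
  by rewrite add0r => /fE; rewrite inE => /and4P[? ? ? ?]; rewrite ys.
- move=> i iA.
  have /matrixP/(_ 0 (enum_rank_in iA i)) := vM; rewrite !mxE => E0; rewrite -[RHS]E0.
  rewrite /= big_split /= /f exchange_big [X in _ + X]exchange_big -big_split /=.
  apply: eq_bigr => k _; rewrite mxE (enum_rankK_in iA) // -!mulr_sumr -mulrDr; congr (_ * _).
  have := enum_valP k; case: (enum_val k) => a b; rewrite inE /= => /and4P[aA bA _ _].
  congr (_ + _).
    rewrite (bigD1 b) //= xpair_eqE eqxx andbT big1 ?addr0 // => j /andP[_ /negPf jb].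
    by rewrite xpair_eqE (eq_sym b) jb andbF.
  rewrite (bigD1 a) //= xpair_eqE eqxx /= big1 ?addr0 // => j /andP[_ /negPf jb].
  by rewrite xpair_eqE (eq_sym a) jb.
- have [k vk] : exists k, v 0 k != 0.
    apply/existsP; apply: contraNT v0 => /existsPn v0; apply/eqP/rowP => k.
    by rewrite mxE; apply/eqP; move/negPn: (v0 k).
  exists (enum_val k).1, (enum_val k).2.
  rewrite -surjective_pairing fk (_ : f _ = 0) ?addr0 //.
  apply/eqP; apply/negPn/negP => /fE; have := enum_valP k.
  by rewrite !inE /lt /= => /and4P[_ _ _ h] /and4P[_ _ _]; rewrite ltnNge (ltnW h).
Qed.

(** The ratio test of the simplex method: the least [al i / - be i] over the decreasing coordinates
    is the longest step that keeps all of them nonnegative. *)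
Lemma first_zero (I : finType) (Q : pred I) (al be : I -> R) :
  (forall i, Q i -> 0 < al i) -> (exists2 i, Q i & be i < 0) ->
  exists2 t, 0 <= t & (forall i, Q i -> 0 <= al i + t * be i) /\
    exists2 i, Q i & al i + t * be i = 0.
Proof.
move=> al0 [i0 Q0 b0].
pose P i := Q i && (be i < 0).
have P0 : P i0 by rewrite /P Q0.
case: (@arg_minP _ _ _ i0 P (fun i => al i / - be i) P0) => i /andP[Qi bi] mi.
exists (al i / - be i); first by rewrite divr_ge0 ?oppr_ge0 ?(ltW (al0 _ _)) // ltW.
have bi0 : - be i != 0 by rewrite oppr_eq0 lt_eqF.
split; last first.
  by exists i => //; rewrite -[X in _ * X]opprK mulrN divfK // subrr.
move=> j Qj; have [bj|bj] := ltP (be j) 0; last first.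
  apply: addr_ge0; first exact: ltW (al0 j Qj).
  by apply: mulr_ge0 => //; apply: divr_ge0; rewrite ?oppr_ge0 ltW // al0.
have := mi j; rewrite /P Qj bj => /(_ isT) le.
have : al i / - be i * - be j <= al j by rewrite -ler_pdivlMr ?oppr_gt0.
by rewrite mulrN lerNl -subr_ge0 opprK addrC.
Qed.

(** Induction on |A|, then on the size of the support. A nontrivial cut of value 1 or a vertex of
    support degree at most 2 leads to smaller vertex sets. Otherwise y moves along a circulation,
    signed so that the cost does not rise, until a pair leaves the support or a nontrivial odd cut
    becomes tight. *)
Theorem edmonds A y c : frac_matching A y ->
  exists s, matching A y s /\
    \sum_(i in A) c i (s i) <= \sum_(i in A) \sum_(j in A) c i j * y i j.
Proof.
suff : forall n A, (#|A| <= n)%N -> edmonds_at A.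
  by move=> H fy; apply: (H #|A| A).
move=> {A y c} n; elim: n => [|n IHn] A cA.
  move=> y c fy; have /eqP -> : A == set0 by rewrite -cards_eq0 -leqn0.
  exists (finfun id); rewrite !big_set0; split=> //.
  by apply/matchingP => i; rewrite inE.
have IH A' : (#|A'| < #|A|)%N -> edmonds_at A' by move=> h; apply: IHn; lia.
move=> y c; pose supp y := [set p : W * W | [&& p.1 \in A, p.2 \in A & 0 < y p.1 p.2]].
have [k] := ubnP #|supp y|; elim: k => // k IHk in y * => ck fy.
have [ys y0 yd yc] := fy.
have [->|A0] := eqVneq A set0.
  exists (finfun id); rewrite !big_set0; split=> //.
  by apply/matchingP => i; rewrite inE.
have eA := frac_matching_even fy.
have [A4|A4] := eqVneq #|A| 4; first exact: edmonds4.
pose nontriv (S : {set W}) := [&& S \subset A, odd #|S|, (1 < #|S|)%N & (#|S| + 1 < #|A|)%N].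
have [/existsP[U /andP[/and4P[UA oU U1 U2] /eqP tU]]|/existsPn nt] :=
    boolP [exists U : {set W}, nontriv U && (cut y A U == 1)].
  exact: (edmonds_tight_cut c fy UA oU tU).
have [|] := boolP [exists i in A, #|[set j in A | (0 < y i j)%R]| <= 2]%N.
  move=> /exists_inP[i iA]; rewrite leq_eqVlt => /orP[/eqP d2|d1].
    have [U [UA cU tU]] := degree2_tight fy iA d2.
    have A2 : (2 < #|A|)%N by rewrite -cU subset_leq_card.
    have := nt U; rewrite /nontriv UA cU tU eqxx andbT /=; lia.
  have [j [jA yij]] : exists j, j \in A /\ y i j = 1.
    have sum0 l : l \in A -> l \notin [set j in A | 0 < y i j] -> y i l = 0.
      by rewrite inE => -> /=; rewrite -leNgt => h; apply/eqP; rewrite eq_le h y0.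
    have [N0|[j jN]] := set_0Vmem [set j in A | 0 < y i j].
      have := yd i iA; rewrite big1 => [/esym/eqP|l lA]; first by rewrite oner_eq0.
      by apply: sum0; rewrite ?N0 ?inE.
    have /cards1P[j' eN] : #|[set j in A | 0 < y i j]| == 1%N.
      by rewrite eqn_leq -ltnS d1 card_gt0; apply/set0Pn; exists j.
    have : j' \in [set j in A | 0 < y i j] by rewrite eN inE.
    rewrite inE => /andP[j'A _]; exists j'; split=> //.
    rewrite -(yd i iA) (big_setD1 j') //= big1 ?addr0 // => l.
    by rewrite !inE => /andP[lj lA]; apply: sum0; rewrite ?eN ?inE.
  exact: (edmonds_delete_pair c fy iA jA yij).
rewrite negb_exists_in => /forall_inP deg.
have [|z0 [zs0 zE0 zd0 [i0 [j0 zij0]]]] := circulation fy A0.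
  by move=> i /deg; rewrite -ltnNge.
pose sg : R := if \sum_(i in A) \sum_(j in A) c i j * z0 i j <= 0 then 1 else -1.
have sg0 : sg != 0 by rewrite /sg; case: ifP; rewrite ?oppr_eq0 oner_eq0.
pose z i j := sg * z0 i j.
have zs i j : z i j = z j i by rewrite /z zs0.
have zE i j : z i j != 0 -> [/\ i \in A, j \in A & 0 < y i j].
  by rewrite /z mulf_eq0 negb_or => /andP[_ /zE0].
have zd i : i \in A -> \sum_(j in A) z i j = 0.
  by move=> iA; rewrite -mulr_sumr zd0 ?mulr0.
have cz : \sum_(i in A) \sum_(j in A) c i j * z i j <= 0.
  have -> : \sum_(i in A) \sum_(j in A) c i j * z i j =
     sg * \sum_(i in A) \sum_(j in A) c i j * z0 i j.
    rewrite mulr_sumr; apply: eq_bigr => i _; rewrite mulr_sumr.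
    by apply: eq_bigr => j _; rewrite mulrCA.
  rewrite /sg; move: (\sum_(i in A) _) => X.
  by case: (leP X 0) => h; rewrite ?mul1r // mulN1r oppr_le0 ltW.
have zij : z i0 j0 != 0 by rewrite mulf_neq0.
have [i0A j0A _] := zE _ _ zij.
(* A nonzero row with sum 0 has a negative entry, so the move meets a constraint. *)
have [j1 zneg] : exists j, z i0 j < 0.
  apply/existsP; apply: contraT => /existsPn H.
  have H' j : 0 <= z i0 j by rewrite leNgt H.
  have := zd i0 i0A => /eqP; rewrite psumr_eq0; last by move=> j _; apply: H'.
  by move=> /allP/(_ j0 (mem_index_enum _)); rewrite j0A (negPf zij).
pose Q (q : (W * W) + {set W}) := match q with
  | inl p => p \in supp y | inr U => nontriv U end.
pose al (q : (W * W) + {set W}) := match q with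
  | inl p => y p.1 p.2 | inr U => cut y A U - 1 end.
pose be (q : (W * W) + {set W}) := match q with
  | inl p => z p.1 p.2 | inr U => cut z A U end.
have [||t t0 [feas [q Qq zq]]] := @first_zero _ Q al be.
- case=> [p|S] /=; first by rewrite inE => /and3P[].
  move=> nS; have := nt S; rewrite nS /= subr_gt0 lt_neqAle eq_sym => ->.
  by case/and4P: nS => SA oS _ _; apply: yc.
- exists (inl (i0, j1)) => //=; have [|? ? ?] := zE i0 j1; first by rewrite lt_eqF.
  by rewrite inE; apply/and3P.
pose y2 i j := y i j + t * z i j.
have cut2 S : cut y2 A S = cut y A S + t * cut z A S.
  rewrite /cut mulr_sumr -big_split; apply: eq_bigr => i _ /=.
  by rewrite mulr_sumr -big_split.
have z0' i j : ~~ [&& i \in A, j \in A & 0 < y i j] -> z i j = 0.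
  move=> h; apply/eqP; apply: contraNT h => /zE[-> -> ->] //.
have y2ge i j : 0 <= y2 i j.
  have [h|/z0' zz] := boolP [&& i \in A, j \in A & 0 < y i j].
    by have := feas (inl (i, j)); apply; rewrite /= inE.
  by rewrite /y2 zz mulr0 addr0.
have sub2 i j : 0 < y2 i j -> 0 < y i j.
  have [/and3P[_ _ ->] //|/z0' zz] := boolP [&& i \in A, j \in A & 0 < y i j].
  by rewrite /y2 zz mulr0 addr0.
have ys2 i j : y2 i j = y2 j i by rewrite /y2 ys zs.
have yd2 i : i \in A -> \sum_(j in A) y2 i j = 1.
  by move=> iA; rewrite /y2 big_split /= -mulr_sumr zd // mulr0 addr0 yd.
have cut1 i : i \in A -> cut y2 A [set i] = 1.
  move=> iA; rewrite cut_deg ?sub1set // cards1 !big_set1 /y2.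
  rewrite z0' (frac_matching_diag fy iA) ?ltxx ?andbF //.
  by rewrite mulr0 addr0 subr0.
have fy2 : frac_matching A y2.
  split=> // S SA oS.
  have [|] := boolP (nontriv S).
    by move=> nS; have := feas (inr S) nS; rewrite /= cut2; lra.
  (* For a single vertex, or all vertices but one, the degree equations alone fix the cut at 1. *)
  rewrite /nontriv SA oS /= negb_and -!leqNgt => /orP[S1|S1].
    have /cards1P[i eS] : #|S| == 1%N by rewrite eqn_leq S1 odd_gt0.
    by rewrite eS cut1 //; rewrite -sub1set -eS.
  have cD : #|A :\: S| = (#|A| - #|S|)%N by rewrite cardsD (setIidPr SA).
  have := subset_leq_card SA => leS.
  have /cards1P[i eS] : #|A :\: S| == 1%N.
    by move: cD S1 leS eA oS; move: #|A| #|S| #|A :\: S|; clear; lia.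
  have iA : i \in A by have := set11 i; rewrite -eS inE => /andP[].
  by rewrite -cut_setD // eS cut1.
have cost2 : \sum_(i in A) \sum_(j in A) c i j * y2 i j <=
             \sum_(i in A) \sum_(j in A) c i j * y i j.
  have -> : \sum_(i in A) \sum_(j in A) c i j * y2 i j =
     \sum_(i in A) \sum_(j in A) c i j * y i j +
     t * \sum_(i in A) \sum_(j in A) c i j * z i j.
    rewrite mulr_sumr -big_split; apply: eq_bigr => i _.
    rewrite mulr_sumr -big_split; apply: eq_bigr => j _ /=.
    by rewrite /y2 mulrDr mulrCA.
  by rewrite gerDl mulr_ge0_le0.
suff [s [ms le]] : exists s, matching A y2 s /\
    \sum_(i in A) c i (s i) <= \sum_(i in A) \sum_(j in A) c i j * y2 i j.
  by exists s; split; [apply: matching_sub ms | apply: le_trans cost2].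
case: q Qq zq => [[i j]|S] /= Qq zq.
  apply: IHk fy2; rewrite -ltnS; apply: leq_trans ck; rewrite ltnS.
  apply: proper_card; apply/properP; split.
    by apply/subsetP => -[a b]; rewrite !inE /= => /and3P[-> -> /sub2->].
  by exists (i, j) => //; rewrite !inE /= /y2 zq ltxx !andbF.
case/and4P: Qq => SA oS S1 S2.
apply: (edmonds_tight_cut c fy2 SA oS) => //.
by rewrite cut2; lra.
Qed.

End PerfectMatching.

(** * The auxiliary graph *)

(** For an involution without fixed points this selects one element of each orbit. *)
Definition lead (T : finType) (f : T -> T) : pred T :=
  fun u => (enum_rank u < enum_rank (f u))%N.

Lemma big_involution (T : finType) (f : T -> T) (V : Type) (idx : V)
    (op : Monoid.com_law idx) (F : T -> V) :
  involutive f -> (forall u, f u != u) ->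
  \big[op/idx]_u F u = \big[op/idx]_(u | lead f u) op (F u) (F (f u)).
Proof.
move=> fK fN; rewrite (bigID (lead f)) /= big_split /=.
congr (op _ _); rewrite (reindex_inj (can_inj fK)) /=; apply: eq_bigl => u.
rewrite /lead fK -leqNgt leq_eqVlt; case: eqP => // /val_inj/enum_rank_inj e.
by have := fN u; rewrite -e eqxx.
Qed.

Lemma odd_sum (T : finType) (P : pred T) (F G : T -> nat) :
  (forall i, P i -> odd (F i) = odd (G i)) ->
  odd (\sum_(i | P i) F i) = odd (\sum_(i | P i) G i).
Proof.
move=> H; apply: (big_ind2 (fun a b => odd a = odd b)) => // a b a' b' e e'.
by rewrite !oddD e e'.
Qed.

Section Gadget.
Variables (R : realFieldType) (I : finType).
Variables (mate : I -> I) (ext : I * bool -> I * bool) (ty : I -> bool).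
Hypotheses (mateK : involutive mate) (mateN : forall u, mate u != u).
Hypotheses (extK : involutive ext) (extN : forall a, ext a != a).
(* [ty u] holds for paths of type II; [nocut] says that no path is a bridge. *)
Hypothesis tyM : forall u, ty (mate u) = ty u.
Hypothesis nocut : forall (S : I -> bool) u0, S (mate u0) != S u0 ->
  (forall a, S (ext a).1 = S a.1) ->
  (forall u, u != u0 -> u != mate u0 -> S (mate u) = S u) -> False.

(* [inl u] is the centre of u, and [inr a] is a dart. *)
Let W : finType := (I + I * bool)%type.

(* The darts of the two ends of a path are joined in two disjoint pairs, chosen
   so that no pair is already joined by [ext]; the graph thus stays simple. *)
Definition swap (u : I) : bool := [exists b, ext (u, b) == (mate u, b)].
Definition opp (a : I * bool) : I * bool := (mate a.1, a.2 (+) swap a.1).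

(** These weights share out the 1/9 that the edges of value 4/9 leave at each centre and dart. On a
    type II path both ends lose their cycle edges together, so the centres are joined to each other.
    On a type I path one end loses both while the other keeps both, so a centre is joined to the
    darts of the other end. *)
Definition wII u : R := if ty u then 9%:R^-1 else 0.
Definition wI u : R := if ty u then 0 else 18%:R^-1.
Definition wO u : R := if ty u then 9%:R^-1 else 18%:R^-1.

Definition wcd (u : I) (a : I * bool) : R :=
  4%:R / 9%:R * (a.1 == u)%:R + wI u * (a.1 == mate u)%:R.

Definition gweight (p q : W) : R := match p, q with
  | inl u, inl v => wII u * (v == mate u)%:R
  | inl u, inr a => wcd u a
  | inr a, inl u => wcd u a
  | inr a, inr b => 4%:R / 9%:R * (b == ext a)%:R + wO a.1 * (b == opp a)%:R
  end.

Lemma swap_mate u : swap (mate u) = swap u.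
Proof.
rewrite /swap mateK; apply/existsP/existsP => -[b /eqP e]; exists b; apply/eqP.
  by rewrite -[LHS]extK -e !extK.
by rewrite -e extK.
Qed.

Lemma oppK : involutive opp.
Proof.
by case=> u b; rewrite /opp /= mateK swap_mate -addbA addbb addbF.
Qed.

(** If no dart keeps its bit along [ext] to the other end of the path, the straight pairing avoids
    [ext]. Otherwise the crossed one does: one dart already goes straight, and if the other crossed,
    both would have the same partner. *)
Lemma opp_ext a : opp a != ext a.
Proof.
case: a => u b; rewrite /opp /=; apply/eqP => e.
have [/existsP[b0 /eqP e0]|/existsPn H] := boolP (swap u); last first.
  have /negPf sw : ~~ swap u by apply/existsPn.
  by have := H b; rewrite -e sw addbF eqxx.
have sw : swap u by apply/existsP; exists b0; rewrite e0.
rewrite sw addbT in e.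
have [bb|bb] := eqVneq b b0; first by move: e e0; rewrite bb => <- [] ; case: (b0).
have : ext (u, b) = ext (u, b0).
  by rewrite -e e0; congr (_, _); move: bb; case: (b); case: (b0).
by move=> /(can_inj extK)[] /eqP; rewrite (negPf bb).
Qed.

Lemma big_dart (V : Type) (idx : V) (op : Monoid.com_law idx) (F : I * bool -> V) :
  \big[op/idx]_a F a = \big[op/idx]_u op (F (u, true)) (F (u, false)).
Proof.
rewrite (eq_bigr (fun a => F (a.1, a.2))); last by case.
rewrite -(pair_bigA _ (fun u b => F (u, b))) /=.
by apply: eq_bigr => u _; rewrite big_bool.
Qed.

Lemma sum_delta (J : finType) (f : J -> R) k j0 :
  \sum_j f j * (k * (j == j0)%:R) = f j0 * k.
Proof.
rewrite (bigD1 j0) //= eqxx mulr1 big1 ?addr0 // => j /negPf->.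
by rewrite !mulr0.
Qed.

Lemma gweight_center (f : W -> R) u : \sum_q f q * gweight (inl u) q =
  wII u * f (inl (mate u)) +
  4%:R / 9%:R * (f (inr (u, true)) + f (inr (u, false))) +
  wI u * (f (inr (mate u, true)) + f (inr (mate u, false))).
Proof.
rewrite big_sumType /= sum_delta big_dart -addrA mulrC; congr (_ + _).
rewrite (eq_bigr (fun v => (f (inr (v, true)) + f (inr (v, false))) *
   (4%:R / 9%:R * (v == u)%:R) + (f (inr (v, true)) + f (inr (v, false))) *
   (wI u * (v == mate u)%:R))).
  by rewrite big_split /= !sum_delta mulrC [in X in _ + X]mulrC.
by move=> v _; rewrite /wcd /=; ring.
Qed.

Lemma gweight_dart (f : W -> R) a : \sum_q f q * gweight (inr a) q =
  4%:R / 9%:R * f (inl a.1) + wI a.1 * f (inl (mate a.1)) +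
  4%:R / 9%:R * f (inr (ext a)) + wO a.1 * f (inr (opp a)).
Proof.
rewrite big_sumType /= -addrA; congr (_ + _).
  rewrite (eq_bigr (fun v => f (inl v) * (4%:R / 9%:R * (v == a.1)%:R) +
     f (inl v) * (wI a.1 * (v == mate a.1)%:R))).
    by rewrite big_split /= !sum_delta mulrC [in X in _ + X]mulrC.
  move=> v _; rewrite /wcd mulrDr (eq_sym a.1 v); congr (_ + f _ * _).
  case: (eqVneq a.1 (mate v)) => [e|ne].
    by rewrite e mateK eqxx /wI tyM.
  by rewrite !mulr0n; case: eqVneq => [e|_]; rewrite ?mulr0 // e mateK eqxx in ne *.
under eq_bigr do rewrite mulrDr.
by rewrite big_split /= !sum_delta mulrC [in X in _ + X]mulrC.
Qed.

Lemma gweight_ge0 p q : 0 <= gweight p q.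
Proof.
have k0 k : 0 <= k%:R :> R by apply: ler0n.
have wII0 u : 0 <= wII u by rewrite /wII; case: (ty u); rewrite ?invr_ge0.
have wI0 u : 0 <= wI u by rewrite /wI; case: (ty u); rewrite ?invr_ge0.
have wO0 u : 0 <= wO u by rewrite /wO; case: (ty u); rewrite ?invr_ge0.
by case: p => ?; case: q => ?; rewrite /= /wcd ?addr_ge0 ?mulr_ge0 ?invr_ge0.
Qed.

Lemma gweight_sym p q : gweight p q = gweight q p.
Proof.
case: p => p; case: q => q //=.
  case: (eqVneq q (mate p)) => [->|ne]; first by rewrite mateK eqxx /wII tyM.
  by case: eqVneq => [e|]; rewrite ?mulr0 // e mateK eqxx in ne *.
congr (_ * _%:R + _).
  by rewrite eq_sym (can2_eq extK extK).
case: (eqVneq q (opp p)) => [->|ne]; first by rewrite oppK eqxx /wO tyM.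
by case: eqVneq => [e|]; rewrite ?mulr0 // e oppK eqxx in ne *.
Qed.

(* Eighteen times the part of the cut contributed by the edges inside the
   gadget of u, counted from its side u. *)
Definition local_cut (t su sw u1 u2 w1 w2 o1 o2 : bool) : nat :=
  (su * (if t then 2 * ~~ sw else ~~ w1 + ~~ w2) + su * (8 * (~~ u1 + ~~ u2)) +
   u1 * (8 * ~~ su + (if t then 2 * ~~ o1 else ~~ sw + ~~ o1)) +
   u2 * (8 * ~~ su + (if t then 2 * ~~ o2 else ~~ sw + ~~ o2)))%N.

(* k tells how the darts u1, u2 of one end are paired with the darts w1, w2 of the
   other.  Either the gadget alone makes the cut large enough, or its share is
   bounded below according to the number d of ends whose two darts are separated
   and to the parity of the gadget's part of the odd set. *)
Lemma local_cut_bound (t su sw u1 u2 w1 w2 k : bool) :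
  let o1 := if k then w2 else w1 in let o2 := if k then w1 else w2 in
  let o1' := if k then u2 else u1 in let o2' := if k then u1 else u2 in
  let odd6 := su (+) sw (+) u1 (+) u2 (+) w1 (+) w2 in
  let d := ((u1 (+) u2) + (w1 (+) w2))%N in
  let total := (local_cut t su sw u1 u2 w1 w2 o1 o2 +
                local_cut t sw su w1 w2 u1 u2 o1' o2')%N in
  (18 <= total)%N \/
  ((10 * (d == 1) + 6 * ((d == 0) && odd6) + 16 * (d == 2) <= total)%N /\
   ((d == 2)%N -> ~~ odd6) /\ ((d == 0)%N -> odd6 = u1 (+) w1)).
Proof.
by case: t; case: su; case: sw; case: u1; case: u2; case: w1; case: w2; case: k;
   ((by left) || (right; split; [by [] | split])).
Qed.

(** In units of 1/18, a crossing cycle edge costs 8; a path costs at least 10 or 16 if one or two of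
    its ends have separated darts, and at least 6 if none has and it meets S oddly. If the sum is
    below 18, then n1 = 0, because n1 = 1 forces a crossing cycle edge and 10 + 8 = 18. Then n2 is
    odd, hence 1, and nothing else fits. The darts in S now define a set of ends that only this path
    crosses, which [nocut] excludes. *)
Lemma gweight_frac_matching : frac_matching [set: W] gweight.
Proof.
have n9 : 9%:R != 0 :> R by rewrite pnatr_eq0.
have n18 : 18%:R != 0 :> R by rewrite pnatr_eq0.
split; [exact: gweight_sym | exact: gweight_ge0 | |].
  move=> p _; rewrite (eq_bigl xpredT) => [|q]; last by rewrite in_setT.
  rewrite (eq_bigr (fun q => 1 * gweight p q)) => [|q _]; last by rewrite mul1r.
  case: p => [u|a]; rewrite ?gweight_center ?gweight_dart /wII /wI /wO;
    case: (ty _); by field; rewrite ?n9 ?n18.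
move=> S _ oS.
pose sb u := inl u \in S; pose la a := inr a \in S.
pose Ln u := local_cut (ty u) (sb u) (sb (mate u)) (la (u, true)) (la (u, false))
  (la (mate u, true)) (la (mate u, false)) (la (opp (u, true))) (la (opp (u, false))).
pose cr := (\sum_a la a * ~~ la (ext a))%N.
have -> : cut gweight [set: W] S = (\sum_u Ln u + 8 * cr)%:R / 18%:R.
  have -> : cut gweight [set: W] S =
      \sum_p (p \in S)%:R * \sum_q (q \notin S)%:R * gweight p q.
    rewrite /cut big_mkcond; apply: eq_bigr => p _.
    case: (p \in S); rewrite ?mul0r // mul1r big_mkcond; apply: eq_bigr => q _.
    by rewrite !inE andbT; case: (q \in S); rewrite ?mul0r ?mul1r.
  rewrite big_sumType /= big_dart -big_split /cr big_dart big_distrr /= -big_split natr_sum.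
  rewrite mulr_suml; apply: eq_bigr => u _ /=.
  rewrite gweight_center !gweight_dart /=.
  rewrite /Ln /local_cut /wII /wI /wO -!/(sb _) -!/(la _).
  by case: (ty u); rewrite !(natrD, natrM); field; rewrite ?n9 ?n18.
suff : (18 <= \sum_u Ln u + 8 * cr)%N.
  by rewrite -(ler_nat R) => h; rewrite ler_pdivlMr ?mul1r // ltr0n.
rewrite (big_involution _ _ mateK mateN) leqNgt; apply/negP => lt18.
pose d u := ((la (u, true) (+) la (u, false)) + (la (mate u, true) (+) la (mate u, false)))%N.
pose od u := sb u (+) sb (mate u) (+) la (u, true) (+) la (u, false)
   (+) la (mate u, true) (+) la (mate u, false).
have bd u : lead mate u ->
  (10 * (d u == 1) + 6 * ((d u == 0) && od u) + 16 * (d u == 2) <= Ln u + Ln (mate u))%N /\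
   ((d u == 2)%N -> ~~ od u) /\ ((d u == 0)%N -> od u = la (u, true) (+) la (mate u, true)).
  move=> lu.
  have : (Ln u + Ln (mate u) < 18)%N.
    apply: leq_ltn_trans lt18; rewrite (bigD1 u) //= -[X in (_ <= X)%N]addnA.
    exact: leq_addr.
  have := local_cut_bound (ty u) (sb u) (sb (mate u)) (la (u, true)) (la (u, false))
    (la (mate u, true)) (la (mate u, false)) (swap u).
  rewrite /Ln tyM mateK /opp /= swap_mate mateK -/(d u) -/(od u).
  have -> : (if swap u then la (mate u, false) else la (mate u, true)) =
             la (mate u, ~~ swap u) by case: (swap u).
  have -> : (if swap u then la (mate u, true) else la (mate u, false)) =
             la (mate u, swap u) by case: (swap u).
  have -> : (if swap u then la (u, false) else la (u, true)) =
             la (u, ~~ swap u) by case: (swap u).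
  have -> : (if swap u then la (u, true) else la (u, false)) =
             la (u, swap u) by case: (swap u).
  by case=> // h1 h2; rewrite leqNgt h2 in h1.
pose n1 := (\sum_(u | lead mate u) (d u == 1))%N.
pose n2 := (\sum_(u | lead mate u) ((d u == 0) && od u))%N.
pose n3 := (\sum_(u | lead mate u) (d u == 2))%N.
have lt18' : (10 * n1 + 6 * n2 + 16 * n3 + 8 * cr < 18)%N.
  apply: leq_ltn_trans lt18; rewrite leq_add2r /n1 /n2 /n3 !big_distrr /= -!big_split.
  by apply: leq_sum => u /bd[].
(* Both numbers have the parity of the number of darts in S, grouped once by ends and once along
   [ext]. *)
have par1 : odd n1 = odd cr.
  have -> : odd n1 = odd (\sum_(u | lead mate u) d u).
    apply: odd_sum => u _; rewrite /d.
    by case: (la (u, true)); case: (la (u, false)); case: (la (mate u, true)); case: (la (mate u, false)).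
  rewrite -(big_involution _ (fun u => nat_of_bool (la (u, true) (+) la (u, false))) mateK mateN).
  have -> : odd (\sum_u (la (u, true) (+) la (u, false)))%N = odd (\sum_a la a)%N.
    rewrite (big_dart _ (fun a => nat_of_bool (la a))); apply: odd_sum => u _.
    by case: (la _); case: (la _).
  have -> : (\sum_a la a = cr + \sum_a (la a && la (ext a)))%N.
    by rewrite /cr -big_split; apply: eq_bigr => a _ /=; case: (la a); case: (la _).
  rewrite oddD (big_involution _ (fun a => nat_of_bool (la a && la (ext a))) extK extN).
  rewrite (_ : odd (\sum_(a | lead ext a) _) = false) ?addbF //.
  rewrite (odd_sum (G := fun=> 0%N)) ?big1 // => a _.
  by rewrite extK andbC; case: (_ && _).
(* A path with two separated ends meets S evenly, so only the paths counted by n2 contribute to the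
   parity of S. *)
have par2 : n1 = 0%N -> odd n2.
  move=> n10; move: oS; rewrite -sum1_card big_mkcond big_sumType /= big_dart -big_split.
  rewrite (big_involution _ _ mateK mateN) => h; apply: etrans h; apply: odd_sum => u lu /=.
  have d1 : d u != 1%N.
    by move/eqP: n10; rewrite sum_nat_eq0 => /forall_inP/(_ u lu); rewrite eqb0.
  have [_ [d2 _]] := bd u lu.
  have {d2} : (d u == 0) && od u = od u.
    move: d1 d2; rewrite /d.
    by do 4 ![case: (la _) => //=]; case: (od u) => // _ /(_ isT).
  move=> ->; rewrite /od /sb /la.
  by do 6 ![case: (_ \in S)].
have [n10 n21 n30 cr0] : [/\ n1 = 0, n2 = 1, n3 = 0 & cr = 0]%N.
  move: lt18' par1 par2; clear.
  move: n1 n2 n3 cr => a b e f h p1 p2.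
  by case: a h p1 p2 => [|a] h p1 p2; [have := p2 erefl; split; lia | exfalso; lia].
have d0 u : lead mate u -> d u = 0%N.
  move=> lu; move/eqP: n10; rewrite sum_nat_eq0 => /forall_inP/(_ u lu).
  move/eqP: n30; rewrite sum_nat_eq0 => /forall_inP/(_ u lu); rewrite /d.
  by case: (_ (+) _); case: (_ (+) _).
have leadP u : lead mate u || lead mate (mate u).
  rewrite /lead mateK -neq_ltn; apply/eqP => /val_inj/enum_rank_inj e.
  by have := mateN u; rewrite -e eqxx.
have cst u b : la (u, b) = la (u, true).
  case: b => //; case/orP: (leadP u) => /d0; rewrite /d ?mateK;
  by do 4 case: (la _).
have [u0 lu0 /andP[_ od0]] : exists2 u, lead mate u & (d u == 0%N) && od u.
  apply/exists_inP; apply: contraT; rewrite negb_exists_in => /forall_inP H.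
  by have := n21; rewrite /n2 big1 // => u lu; rewrite (negPf (H u lu)).
have oth u : lead mate u -> u != u0 -> ~~ od u.
  move=> lu ne; apply/negP => ou; have := n21; rewrite /n2 (bigD1 u0) //= (bigD1 u) ?lu //=.
  by rewrite !d0 // od0 ou.
have odE u : lead mate u -> od u = la (u, true) (+) la (mate u, true).
  by move=> lu; have [_ [_ h]] := bd u lu; apply: h; rewrite d0.
apply: (@nocut (fun u => la (u, true)) u0).
- by move: od0; rewrite odE //; case: (la _); case: (la _).
- move=> a; rewrite -(cst _ (ext a).2) -(cst _ a.2) -!surjective_pairing.
  have le b : la b -> la (ext b).
    move/eqP: cr0; rewrite sum_nat_eq0 => /forall_inP/(_ b isT).
    by case: (la b); case: (la _).
  by apply/idP/idP => /le //; rewrite extK.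
- move=> u uu0 umu0; case/orP: (leadP u) => lu.
    by have := oth u lu uu0; rewrite odE //; case: (la _); case: (la _).
  have := oth _ lu; rewrite odE // mateK => /(_ _); case: (la _); case: (la _) => //= -> //.
    by apply: contraNneq umu0 => <-; rewrite mateK.
  by apply: contraNneq umu0 => <-; rewrite mateK.
Qed.

(* P is the cost of the path of u, and A u and A0 u those of the patterns used
   when u loses both cycle edges and when neither end loses any. *)
Variables (P A0 A : I -> R) (ce : I * bool -> R).
Hypotheses (P_mate : forall u, P (mate u) = P u) (A0_mate : forall u, A0 (mate u) = A0 u).
(** Two different patterns together use each edge at least twice, and all three exactly four times.
    For type II [A0] is the cheaper of the two patterns other than [A], which gives the second
    inequality of [A_II]. *)
Hypothesis A_I : forall u, ~~ ty u ->
  2%:R * P u <= A u + A (mate u) /\ A0 u + A u + A (mate u) = 4%:R * P u.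
Hypothesis A_II : forall u, ty u ->
  [/\ A (mate u) = A u, 2%:R * A0 u + A u <= 4%:R * P u & 2%:R * P u <= A u + A0 u].

(* N holds on the darts whose cycle edge is dropped. *)
Definition ncount (N : I * bool -> bool) u : nat := (N (u, true) + N (u, false))%N.

Definition path_cost (N : I * bool -> bool) u : R :=
  if ncount N u == 1%N then P u else if ncount N u == 2%N then A u
  else if ncount N (mate u) == 2%N then A (mate u) else A0 u.

(** The reference is to use every path once and drop nothing. Edges between the ends of a path carry
    the excess of the pattern they stand for, dropped edges their saving. Pairs of the same kind are
    met from both sides, hence the halves; a centre matched across to a dart is charged at the
    centre only. *)
Definition gcost (p q : W) : R := match p, q with
  | inl u, inl v => (A u - P u) / 2%:R
  | inl u, inr a => if a.1 == u then 0 else A u - P u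
  | inr a, inl u => 0
  | inr a, inr b => if b == ext a then - ce a / 2%:R else (A0 a.1 - P a.1) / 2%:R
  end.

Lemma gcost_frac : \sum_p \sum_q gcost p q * gweight p q <=
  \sum_u (P u / 18%:R - 4%:R / 9%:R * ((ce (u, true) + ce (u, false)) / 2%:R)).
Proof.
have n9 : 9%:R != 0 :> R by rewrite pnatr_eq0.
have n18 : 18%:R != 0 :> R by rewrite pnatr_eq0.
rewrite big_sumType /= big_dart -big_split /=.
(* Over both ends of a path this adds up to (A u + A (mate u) + A0 u - 3 P u)/9 for type I and (A u
   + 2 A0 u - 3 P u)/9 for type II, at most P u / 9 in either case. *)
pose K u : R := if ty u then (A u - P u) / 18%:R + (A0 u - P u) / 9%:R
              else (A u - P u) / 9%:R + (A0 u - P u) / 18%:R.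
rewrite (eq_bigr (fun u => K u - 4%:R / 9%:R * ((ce (u, true) + ce (u, false)) / 2%:R))).
  rewrite !big_split /= lerD2r (big_involution _ _ mateK mateN).
  rewrite [X in _ <= X](big_involution _ _ mateK mateN) /=; apply: ler_sum => u _.
  rewrite /K tyM P_mate A0_mate.
  case tu : (ty u); first by have [-> h1 h2] := A_II tu; lra.
  by have [h1 h2] := A_I (negbT tu); lra.
move=> u _; rewrite gweight_center !gweight_dart /= !eqxx (negPf (mateN u)).
rewrite !(negPf (opp_ext _)) /K /wII /wI /wO.
by case: (ty u); field; rewrite ?n9 ?n18 ?pnatr_eq0.
Qed.

(** * What a perfect matching says about cycle edges and paths *)

Section Matched.
Variable s : {ffun W -> W}.
Hypothesis ms : matching [set: W] gweight s.

Let N a := s (inr a) == inr (ext a).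
Let Q a := s (inr a) == inr (opp a).
Let nS u := ((s (inl u) == inr (u, true)) + (s (inl u) == inr (u, false)))%N.
Let nX u := ((s (inl u) == inr (mate u, true)) + (s (inl u) == inr (mate u, false)))%N.
Let nZ u := nat_of_bool (s (inl u) == inl (mate u)).
Let nQ u := (Q (u, true) + Q (u, false))%N.

Lemma sum_eqE :
  ((forall u v, (inl u == inl v :> W) = (u == v)) *
   (forall a b, (inr a == inr b :> W) = (a == b)) *
   (forall u a, (inl u == inr a :> W) = false) *
   (forall u a, (inr a == inl u :> W) = false))%type.
Proof. by []. Qed.

Lemma matched_sym p q : (s p == q) = (s q == p).
Proof.
have sK r : s (s r) = r by have [] := matchingP _ _ _ ms r (in_setT _).
by rewrite (can2_eq sK sK) eq_sym.
Qed.

Lemma matched_gt0 p : 0 < gweight p (s p).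
Proof. by have [] := matchingP _ _ _ ms p (in_setT _). Qed.

Lemma dart_matched a : (N a + (s (inr a) == inl a.1) + (s (inr a) == inl (mate a.1)) + Q a)%N = 1%N
  /\ (ty a.1 -> (s (inr a) == inl (mate a.1)) = false).
Proof.
have := matched_gt0 (inr a); rewrite /N /Q; case: (s (inr a)) => [v|b]; rewrite !sum_eqE /=.
  rewrite /wcd /wI; case: (eqVneq v a.1) => [->|ne].
    by rewrite [a.1 == mate _]eq_sym (negPf (mateN _)).
  rewrite mulr0 add0r; case: (eqVneq v (mate a.1)) => [->|ne'].
    by rewrite mateK eqxx tyM; case: (ty a.1); rewrite ?mul0r ?ltxx.
  rewrite (_ : (a.1 == mate v) = false) ?mulr0 ?ltxx //.
  by apply: contraNF ne' => /eqP->; rewrite mateK.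
case: (eqVneq b (ext a)) => [->|ne].
  by rewrite [ext a == _]eq_sym (negPf (opp_ext a)).
by rewrite mulr0 add0r; case: (b == opp a) => //; rewrite mulr0 ltxx.
Qed.

Lemma center_matched u : (nS u + nX u + nZ u)%N = 1%N /\
  (if ty u then nX u = 0%N else nZ u = 0%N).
Proof.
have := matched_gt0 (inl u); rewrite /nS /nX /nZ; case: (s (inl u)) => [v|[v b]];
  rewrite !sum_eqE /=.
  rewrite /wII; case: (ty u); last by rewrite mul0r ltxx.
  by case: (v == mate u); rewrite ?mulr0 ?ltxx.
rewrite /wcd /wI !xpair_eqE /=; case: (eqVneq v u) => [->|ne].
  by rewrite (eq_sym u) (negPf (mateN u)); case: (b); case: (ty u).
rewrite mulr0 add0r; case: (v == mate u); last by rewrite mulr0 ltxx.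
by case: (ty u); rewrite ?mul0r ?ltxx //; case: (b).
Qed.

Lemma matched_counts u : [/\ (ncount N u + nS u + nX (mate u) + nQ u = 2)%N,
  nQ (mate u) = nQ u & nZ (mate u) = nZ u].
Proof.
split.
- have [h1 _] := dart_matched (u, true); have [h2 _] := dart_matched (u, false).
  move: h1 h2; rewrite /ncount /nS /nX /nQ /= mateK.
  rewrite ![s (inr _) == inl _]matched_sym.
  move: (N (u, true)) (N (u, false)) (s (inl u) == inr (u, true))
    (s (inl u) == inr (u, false)) (s (inl (mate u)) == inr (u, true))
    (s (inl (mate u)) == inr (u, false)) (Q (u, true)) (Q (u, false)).
  by clear; do 8 case.
- have Qo a : Q (opp a) = Q a by rewrite /Q oppK matched_sym.
  by rewrite /nQ -[Q (u, true)]Qo -[Q (u, false)]Qo /opp /=; case: (swap u); rewrite //= addnC.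
- by rewrite /nZ mateK matched_sym.
Qed.

Definition excess u : R := (nX u)%:R * (A u - P u) + (nZ u)%:R * ((A u - P u) / 2%:R)
  + (nQ u)%:R * ((A0 u - P u) / 2%:R).

Lemma gcost_matched : \sum_p gcost p (s p) =
  \sum_u (excess u - ((N (u, true))%:R * ce (u, true) + (N (u, false))%:R * ce (u, false)) / 2%:R).
Proof.
have cu u : gcost (inl u) (s (inl u)) =
    (nX u)%:R * (A u - P u) + (nZ u)%:R * ((A u - P u) / 2%:R).
  have [] := center_matched u; rewrite /nS /nX /nZ; case: (s (inl u)) => [v|[v b]];
    rewrite !sum_eqE /=.
    by case: (v == mate u) => // _ _; rewrite mul0r add0r mul1r.
  rewrite !xpair_eqE; case: (eqVneq v u) => [->|ne].
    by rewrite (eq_sym u) (negPf (mateN u)) !mul0r addr0.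
  by case: (v == mate u) => //; case: (b) => // _ _; rewrite mul0r mul1r addr0.
have da a : gcost (inr a) (s (inr a)) =
    (Q a)%:R * ((A0 a.1 - P a.1) / 2%:R) - (N a)%:R * ce a / 2%:R.
  have [] := dart_matched a; rewrite /N /Q; case: (s (inr a)) => [v|b];
    rewrite !sum_eqE /=; first by rewrite !mul0r subr0.
  case: (eqVneq b (ext a)) => [->|ne].
    by rewrite [ext a == _]eq_sym (negPf (opp_ext a)) mul0r add0r mul1r mulNr.
  by case: (b == opp a) => // _ _; rewrite !mul0r subr0 mul1r.
pose G (p : W) : R := match p with
  | inl u => (nX u)%:R * (A u - P u) + (nZ u)%:R * ((A u - P u) / 2%:R)
  | inr a => (Q a)%:R * ((A0 a.1 - P a.1) / 2%:R) - (N a)%:R * ce a / 2%:R end.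
rewrite (eq_bigr G) => [|[u|a] _]; [|exact: cu|exact: da].
rewrite big_sumType /= big_dart -big_split; apply: eq_bigr => u _ /=.
by rewrite /excess /nQ natrD; ring.
Qed.

(** A matching may contain several edges that stand for patterns of one path, for instance when both
    centres are matched across. The path then follows at most one pattern but is charged several
    excesses, and [2 P <= A u + A (mate u)] or [2 P <= A u + A0 u] shows that the charge still
    suffices. *)
Lemma path_cost_matched u : path_cost N u <= P u + excess u + excess (mate u).
Proof.
have [e1 q1 z1] := matched_counts u; have [e2 _ _] := matched_counts (mate u).
have [f1 f2] := center_matched u; have [f3 f4] := center_matched (mate u).
rewrite mateK q1 in e2; rewrite z1 in f3 f4.
rewrite /path_cost /excess P_mate A0_mate q1 z1.
move: e1 e2 f1 f2 f3 f4; rewrite tyM.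
move: (ncount N u) (ncount N (mate u)) (nS u) (nS (mate u)) (nX u) (nX (mate u)) (nQ u) (nZ u).
move=> n n' S S' X X' q z e1 e2 f1 f2 f3 f4.
have le1 a b : (a + b)%N = 1%N -> (a = 1 /\ b = 0 \/ a = 0 /\ b = 1)%N.
  by case: a => [|[|a]]; case: b => [|[|b]] // _; [right | left].
case tu : (ty u) f2 f4 => f2 f4.
  have [am h1 h2] := A_II tu; rewrite am; subst X X'; rewrite !addn0 in e1 e2 f1 f3.
  case: (le1 _ _ f1) => -[? ?]; subst S z.
    rewrite addn0 in f3; subst S'.
    rewrite addn1 addSn in e1; rewrite addn1 addSn in e2; case: e1 e2 => e1 [e2].
    case: (le1 _ _ e1) => -[? ?]; subst n q; rewrite ?addn0 ?addn1 in e2.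
      by subst n' => /=; lra.
    by case: e2 => ?; subst n' => /=; lra.
  have {f3}? : S' = 0%N by case: S' f3 {e2} => //= k; rewrite addn1.
  subst S'; rewrite !addn0 in e1 e2.
  by case: q e1 e2 => [|[|[|q]]]; rewrite ?addn0 ?addn1 ?addn2 ?addnS;
    [move=> -> -> | move=> [->] [->] | move=> [->] [->] | ]; rewrite //=; lra.
have [h1 h2] := A_I (negbT tu); subst z; rewrite !addn0 in f1 f3.
case: (le1 _ _ f1) (le1 _ _ f3) => -[? ?] [[? ?]|[? ?]]; subst S S' X X'.
- rewrite addn0 addn1 addSn in e1; rewrite addn0 addn1 addSn in e2; case: e1 e2 => e1 [e2].
  case: (le1 _ _ e1) => -[? ?]; subst n q; rewrite ?addn0 ?addn1 in e2.
    by subst n' => /=; lra.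
  by case: e2 => ?; subst n' => /=; lra.
- have [? ?] : n = 0%N /\ q = 0%N by move: e1; clear; lia.
  subst n q; rewrite !addn0 in e2; rewrite e2 /=; lra.
- have [? ?] : n' = 0%N /\ q = 0%N by move: e2; clear; lia.
  subst n' q; rewrite !addn0 in e1; rewrite e1 /=; lra.
- rewrite addn0 addn1 addSn in e1; rewrite addn0 addn1 addSn in e2; case: e1 e2 => e1 [e2].
  case: (le1 _ _ e1) => -[? ?]; subst n q; rewrite ?addn0 ?addn1 in e2.
    by subst n' => /=; lra.
  by case: e2 => ?; subst n' => /=; lra.
Qed.

Lemma matched_states u :
  if ty u then ncount N (mate u) = ncount N u
  else (ncount N u + ncount N (mate u) = 2)%N \/
       (ncount N u = 0%N /\ ncount N (mate u) = 0%N).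
Proof.
have [e1 q1 z1] := matched_counts u; have [e2 _ _] := matched_counts (mate u).
have [f1 f2] := center_matched u; have [f3 f4] := center_matched (mate u).
rewrite mateK q1 in e2; rewrite z1 in f3 f4.
move: e1 e2 f1 f2 f3 f4; rewrite tyM; case: (ty u); lia.
Qed.

End Matched.

(** The sums run over darts and ends, so a cycle edge and a path are each counted twice; accordingly
    the inequality for the matching enters twice. *)
Theorem gadget : exists N : I * bool -> bool, [/\
  forall a, N (ext a) = N a,
  forall u, if ty u then ncount N (mate u) = ncount N u
    else (ncount N u + ncount N (mate u) = 2)%N \/
         (ncount N u = 0%N /\ ncount N (mate u) = 0%N)
  & \sum_u ((~~ N (u, true))%:R * ce (u, true) + (~~ N (u, false))%:R * ce (u, false)
            + path_cost N u)
    <= \sum_u (5%:R / 9%:R * (ce (u, true) + ce (u, false)) + 10%:R / 9%:R * P u)].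
Proof.
have [s [ms le]] := edmonds gcost gweight_frac_matching.
exists (fun a => s (inr a) == inr (ext a)); split.
- by move=> a; rewrite extK (matched_sym ms).
- exact: matched_states.
have {}le : \sum_p gcost p (s p) <= \sum_p \sum_q gcost p q * gweight p q.
  rewrite (eq_bigl (fun p => p \in [set: W])) => [|p]; last by rewrite in_setT.
  apply: le_trans le _; rewrite le_eqVlt; apply/orP; left; apply/eqP.
  by apply: eq_big => [p|p _]; rewrite ?in_setT //; apply: eq_bigl => q; rewrite in_setT.
pose N a := s (inr a) == inr (ext a); pose l := excess s.
have h : \sum_u (l u - ((N (u, true))%:R * ce (u, true) + (N (u, false))%:R * ce (u, false)) / 2%:R)
   <= \sum_u (P u / 18%:R - 4%:R / 9%:R * ((ce (u, true) + ce (u, false)) / 2%:R)).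
  by rewrite -(gcost_matched ms); apply: le_trans le gcost_frac.
have pc u : path_cost N u <= P u + l u + l (mate u) := path_cost_matched ms u.
rewrite !sumrB in h; rewrite -/N; clearbody l.
have hp : \sum_u path_cost N u <= \sum_u (P u + 2%:R * l u).
  apply: le_trans (ler_sum _ (fun u _ => pc u)) _.
  rewrite [X in _ <= X]big_split /= -mulr_sumr !big_split /= -addrA lerD2l.
  have <- : \sum_u l u = \sum_u l (mate u) by rewrite (reindex_inj (can_inj mateK)).
  by rewrite mulrDl mul1r.
have hN : \sum_u ((~~ N (u, true))%:R * ce (u, true) + (~~ N (u, false))%:R * ce (u, false)) =
   \sum_u (ce (u, true) + ce (u, false)) -
   2%:R * \sum_u ((N (u, true))%:R * ce (u, true) + (N (u, false))%:R * ce (u, false)) / 2%:R.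
  rewrite mulr_sumr -sumrB; apply: eq_bigr => u _.
  by case: (N _); case: (N _) => /=; field.
rewrite big_split /= hN [X in _ <= X]big_split /= -!mulr_sumr.
move: hp h; rewrite big_split /= -!mulr_sumr -!mulr_suml.
lra.
Qed.

End Gadget.

(** * Half vertices and links of a fractional 2-matching *)

Lemma edges2 (V : finType) (u v : V) : ([set u; v] \in edges V) = (u != v).
Proof. by rewrite inE cards2; case: (u != v). Qed.

Lemma edgesP (V : finType) (e : {set V}) : e \in edges V ->
  exists u v, u != v /\ e = [set u; v].
Proof. by rewrite inE => /cards2P. Qed.

Lemma set2C (V : finType) (u v : V) : [set u; v] = [set v; u].
Proof. by rewrite setUC. Qed.

Lemma set2_inj (V : finType) (u v w : V) : [set u; v] = [set u; w] -> v = w.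
Proof.
move=> e; have : v \in [set u; w] by rewrite -e !inE eqxx orbT.
have : w \in [set u; v] by rewrite e !inE eqxx orbT.
by rewrite !inE => /orP[/eqP->|/eqP->] // /orP[/eqP->|/eqP->].
Qed.

Lemma set2_eq (V : finType) (u v a b : V) : [set u; v] = [set a; b] ->
  (u = a /\ v = b) \/ (u = b /\ v = a).
Proof.
move=> e; have : u \in [set a; b] by rewrite -e !inE eqxx.
rewrite !inE => /orP[] /eqP eu; [left | right]; split=> //; move: e; rewrite eu.
  exact: set2_inj.
by rewrite (set2C a); apply: set2_inj.
Qed.

Lemma big_delta (V : finType) (T : Type) (idx : T) (op : Monoid.com_law idx)
    (F : {set V} -> T) v :
  \big[op/idx]_(e in delta v) F e = \big[op/idx]_(w | w != v) F [set v; w].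
Proof.
have -> : delta v = [set [set v; w] | w in [set~ v]].
  apply/setP => e; apply/idP/imsetP => [|[w]]; last first.
    by rewrite !inE => wv ->; rewrite cards2 (eq_sym v) wv !inE eqxx.
  rewrite inE => /andP[/edgesP[a [b [ab ->]]]]; rewrite !inE => /orP[] /eqP->.
    by exists b; rewrite // !inE eq_sym.
  by exists a; rewrite ?inE // setUC.
rewrite big_imset /=; last by move=> a b _ _ /set2_inj.
by apply: eq_bigl => w; rewrite !inE.
Qed.

Lemma bigcup_seqP (T : eqType) (U : finType) (s : seq T) (F : T -> {set U}) e :
  reflect (exists2 l, l \in s & e \in F l) (e \in \bigcup_(l <- s) F l).
Proof.
elim: s => [|a s IH]; first by rewrite big_nil inE; constructor; case.
rewrite big_cons inE; apply: (iffP orP) => [[ea|/IH[l ls el]]|[l]].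
- by exists a; rewrite ?mem_head.
- by exists l; rewrite // inE ls orbT.
- by rewrite inE => /orP[/eqP->|ls] el; [left | right; apply/IH; exists l].
Qed.

Lemma zip_path (V : eqType) (r : rel V) u p :
  path r u p = all (fun uv => r uv.1 uv.2) (zip (u :: p) p).
Proof. by elim: p u => //= v p IH u; rewrite IH. Qed.

Lemma zip_rcons_in (V : eqType) (a b u w : V) q :
  (a, b) \in zip (u :: rcons q w) (rcons q w) ->
  a \in u :: q /\ b \in rcons q w.
Proof.
elim: q u => [|v q IH] u /=; first by rewrite !inE => /eqP[-> ->].
rewrite inE => /orP[/eqP[-> ->]|/IH[]]; first by rewrite !inE !eqxx.
by rewrite !inE => /orP[]-> ->; rewrite ?orbT.
Qed.

(** * Edges of value 1 and 1/2 at a vertex *)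

Section Structure.
Variables (R : realType) (V : finType) (c x : {set V} -> R).
Hypothesis hx : F2M c x.
Hypothesis hcut : forall e, ~ cut_edge x e.

Definition one : rel V := fun u v => (u != v) && (x [set u; v] == 1).
Definition hlf : rel V := fun u v => (u != v) && (x [set u; v] == 1 / 2%:R).
Definition half : pred V := fun v => [exists w, hlf v w].

Lemma oneC u v : one u v = one v u.
Proof. by rewrite /one eq_sym set2C. Qed.
Lemma hlfC u v : hlf u v = hlf v u.
Proof. by rewrite /hlf eq_sym set2C. Qed.

Lemma x_sum v : \sum_(w | w != v) x [set v; w] = 2%:R.
Proof. by case: hx => -[[h _] _] _; rewrite -big_delta h. Qed.

Lemma x_ge0 u v : u != v -> 0 <= x [set u; v].
Proof. by case: hx => -[[_ h] _] _; rewrite -edges2 => /h/andP[]. Qed.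

Lemma half_neq1 : 1 / 2%:R != 1 :> R.
Proof. by apply/eqP; lra. Qed.

(** The two edges of value 1 exhaust the degree 2 of v. *)
Lemma one_two v a b w : one v a -> one v b -> a != b -> w != v -> w != a -> w != b ->
  x [set v; w] = 0.
Proof.
move=> /andP[va /eqP xa] /andP[vb /eqP xb] ab wv wa wb; have := x_sum v.
rewrite (bigD1 a) 1?eq_sym //= (bigD1 b) /=; last by rewrite eq_sym vb eq_sym.
rewrite (bigD1 w) /=; last by rewrite wv wa wb.
rewrite xa xb.
have : 0 <= \sum_(i | (((i != v) && (i != a)) && (i != b)) && (i != w)) x [set v; i].
  by apply: sumr_ge0 => i /andP[/andP[/andP[iv _] _] _]; rewrite x_ge0 // eq_sym.
have := x_ge0 wv; rewrite (set2C w) => h1 h2 h3; apply/eqP; rewrite eq_le h1 andbT; lra.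
Qed.

Lemma one_two_or v a b w : one v a -> one v b -> a != b -> one v w -> w = a \/ w = b.
Proof.
move=> va vb ab /andP[vw /eqP xw].
have [->|wa] := eqVneq w a; first by left.
have [->|wb] := eqVneq w b; first by right.
have := one_two va vb ab _ wa wb; rewrite eq_sym vw => /(_ isT) x0.
by have := oner_neq0 R; rewrite -xw x0 eqxx.
Qed.

Lemma one_two_not_half v a b : one v a -> one v b -> a != b -> ~~ half v.
Proof.
move=> va vb ab; apply/existsPn => w; apply/negP => /andP[vw /eqP xw].
have [e|wa] := eqVneq w a.
  by case/andP: va => _ /eqP; rewrite -e xw => /eqP; rewrite (negPf half_neq1).
have [e|wb] := eqVneq w b.
  by case/andP: vb => _ /eqP; rewrite -e xw => /eqP; rewrite (negPf half_neq1).
have := one_two va vb ab _ wa wb; rewrite eq_sym vw xw => /(_ isT)/eqP.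
by rewrite mulf_eq0 oner_eq0 invr_eq0 pnatr_eq0.
Qed.

Lemma support2 u v : ([set u; v] \in Defs.support x) = (u != v) && (0 < x [set u; v]).
Proof. by rewrite /Defs.support in_set edges2. Qed.

Lemma one_support u v : one u v -> [set u; v] \in Defs.support x.
Proof. by rewrite support2 => /andP[-> /eqP->]; rewrite ltr01. Qed.

Lemma component_edge (A : {set {set V}}) v a b : a \in component A v -> [set a; b] \in A ->
  b \in component A v.
Proof. by rewrite !inE => va ab; apply: connect_trans va (connect1 _). Qed.

Lemma component_mem (A : {set {set V}}) C v : C \in components A -> v \in C -> C = component A v.
Proof.
case/imsetP=> v0 _ ->; rewrite inE => h.
have sA : connect_sym (adj A) by apply: sym_connect_sym; move=> a b; rewrite /adj /= set2C.
by apply/setP => w; rewrite !inE (same_connect sA h).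
Qed.

Lemma component_in (A : {set {set V}}) v : component A v \in components A.
Proof. by apply: imset_f. Qed.

Lemma component_self (A : {set {set V}}) v : v \in component A v.
Proof. by rewrite inE connect0. Qed.

Lemma cycle_neighbours (p : seq V) v : simple_cycle p -> v \in p ->
  [/\ [set v; next p v] \in cycle_edges p, [set v; prev p v] \in cycle_edges p,
      next p v != prev p v, next p v != v & prev p v != v].
Proof.
move=> /andP[s3 up] vp.
have pp : prev p v \in p by rewrite mem_prev.
have h1 : [set v; next p v] \in cycle_edges p by apply/imsetP; exists v.
have h2 : [set v; prev p v] \in cycle_edges p.
  by apply/imsetP; exists (prev p v); rewrite // next_prev // set2C.
have nv w : w \in p -> next p w != w.
  move=> wp; case: (rot_to wp) => i q e.
  rewrite -(next_rot i up) e; move: s3 up; rewrite -(size_rot i) -(rot_uniq i) e.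
  by case: q {e} => //= b q _; rewrite eqxx !inE => /andP[/norP[wb _] _]; rewrite eq_sym.
split=> //; last 2 first.
- exact: nv.
- by have := nv _ pp; rewrite next_prev // eq_sym.
apply/eqP => np; have : next p (next p v) = v by rewrite np next_prev.
case: (rot_to vp) => i q e; rewrite -!(next_rot i up) e.
move: s3 up; rewrite -(size_rot i) -(rot_uniq i) e.
case: q {e} => [|a [|b q]] //= _; rewrite eqxx !inE !negb_or.
move=> /andP[/and3P[va vb _] _]; rewrite (eq_sym a) (negPf va) eqxx => bv.
by rewrite bv eqxx in vb.
Qed.

Lemma path_inner u q w v : uniq (u :: rcons q w) -> path one u (rcons q w) -> v \in q ->
  exists a b, [/\ one v a, one v b, a != b, a \in u :: rcons q w & b \in u :: rcons q w].
Proof.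
move=> un pt vq; case/splitPr: vq un pt => q1 q2.
rewrite rcons_cat rcons_cons cat_path => un /= /and3P[_ h1 h2].
have [b [q3 e]] : exists b q3, rcons q2 w = b :: q3.
  by case: (q2) => [|b q3] /=; [exists w, [::] | exists b, (rcons q3 w)].
move: h2; rewrite e /= => /andP[h2 _].
exists (last u q1), b; rewrite oneC h1 h2; split=> //.
- apply/eqP => lb; move: un; rewrite -cat_cons cat_uniq e => /and3P[_ /hasPn h _].
  have := h b; rewrite !in_cons eqxx orbT => /(_ isT) /=.
  by rewrite -lb -[_ || _]/(last u q1 \in u :: q1) mem_last.
- by rewrite -cat_cons mem_cat mem_last.
- by rewrite -cat_cons mem_cat !inE eqxx !orbT.
Qed.

Lemma link_path (l : link V) : (forall e, e \in link_edges l -> e \in edges V /\ x e = 1) ->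
  path one l.1.1 (rcons l.1.2 l.2).
Proof.
move=> h; rewrite zip_path; apply/allP => -[a b] ab /=.
have [] := h [set a; b]; first by rewrite inE; apply/mapP; exists (a, b).
by rewrite edges2 /one => -> ->; rewrite eqxx.
Qed.

Lemma integer_vertex C v : integer_component x C -> v \in C ->
  exists a b, [/\ one v a, one v b & a != b].
Proof.
move=> [p [sp -> _ xe]]; rewrite inE => vp.
have [h1 h2 h3 h4 h5] := cycle_neighbours sp vp.
by exists (next p v), (prev p v); rewrite /one eq_sym h4 (eq_sym v) h5 !xe ?eqxx.
Qed.

Definition one_vertex v := exists a b, [/\ one v a, one v b & a != b].
Definition half_vertex v := exists a b, [/\ hlf v a, hlf v b, a != b,
   forall w, w != v -> w != a -> w != b -> x [set v; w] = 0 \/ one v w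
 & exists q w, [/\ uniq (v :: rcons q w), path one v (rcons q w) & half w]].

(** The global decomposition becomes local here. Integer components and inner vertices of paths give
    two edges of value 1. On a cycle the two cycle edges contribute 1 in all, so the degree 2
    requires a further edge; it belongs to a path, and v, lying on a cycle, is an end of that
    path. *)
Lemma vertex_cases v : one_vertex v \/ half_vertex v.
Proof.
have vC := component_self (Defs.support x) v.
have cC := component_in (Defs.support x) v.
move: (component _ v) vC cC => C vC cC.
case: (hx) => _ /(_ C cC)[/integer_vertex/(_ vC)|]; first by left.
move=> [cs [ls /= [cyc lnk [un eC] eE [xc xl]]]].
have lsub l e : l \in ls -> e \in link_edges l -> e \in edges_in (Defs.support x) C.
  by move=> lls el; rewrite eE inE; apply/orP; right; apply/bigcup_seqP; exists l.
have lpath l : l \in ls -> path one l.1.1 (rcons l.1.2 l.2).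
  move=> lls; apply: link_path => e el; split; last exact: xl el.
  by have := lsub l e lls el; rewrite inE => /andP[]; rewrite inE => /andP[].
have cst p v' : p \in cs -> v' \in p -> [/\ hlf v' (next p v'), hlf v' (prev p v')
     & next p v' != prev p v'].
  move=> pcs vp; have [sp _] := cyc p pcs.
  have [h1 h2 h3 h4 h5] := cycle_neighbours sp vp.
  by rewrite /hlf (eq_sym v') h4 (eq_sym v') h5 !(xc p) ?eqxx.
have fhalf v' : v' \in flatten cs -> half v'.
  by move=> /flattenP[p pcs vp]; apply/existsP; exists (next p v'); have [] := cst p v' pcs vp.
have := vC; rewrite eC inE mem_cat => /orP[vf|]; last first.
  move=> /flattenP[q /mapP[l lls ->] vq]; left.
  have [ul _ _] := lnk l lls.
  by have [a [b [? ? ? _ _]]] := path_inner ul (lpath l lls) vq; exists a, b.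
right; have /flattenP[p pcs vp] := vf.
have [ha hb ab] := cst p v pcs vp.
have ucs : uniq (flatten cs) by move: un; rewrite cat_uniq => /and3P[].
have only_p p' : p' \in cs -> v \in p' -> p' = p.
  move=> p'cs vp'; case/splitPr: pcs ucs p'cs => cs1 cs2.
  rewrite flatten_cat /= uniq_catCA cat_uniq => /and3P[_ /hasPn h _].
  have /negP hv : v \notin flatten cs1 ++ flatten cs2 by apply/negP => /h /=; rewrite vp.
  rewrite mem_cat inE => /or3P[p1|/eqP //|p2]; case: hv; rewrite mem_cat; apply/orP;
    [left|right]; by apply/flattenP; exists p'.
have others w : w != v -> w != next p v -> w != prev p v -> x [set v; w] != 0 ->
    exists2 l, l \in ls & [set v; w] \in link_edges l.
  move=> wv wn wp x0.
  have sup : [set v; w] \in Defs.support x.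
    by rewrite support2 eq_sym wv lt_def x0 x_ge0 // eq_sym.
  have : [set v; w] \in edges_in (Defs.support x) C.
    rewrite inE sup; apply/subsetP => z; rewrite !inE => /orP[] /eqP-> //.
    by rewrite (component_mem cC vC); apply: component_edge sup; apply: component_self.
  rewrite eE inE => /orP[] /bigcup_seqP[]; last by move=> l; exists l.
  move=> p' p'cs /imsetP[z zp' ez]; exfalso.
  have [sp' _] := cyc p' p'cs; have /andP[_ up'] := sp'.
  case: (set2_eq ez) => -[e1 e2].
    by move: wn; rewrite e2 -e1 (only_p p') ?eqxx // e1.
  have vp' : v \in p' by rewrite e1 mem_next.
  by move: wp; rewrite e2 e1 -(only_p p' p'cs vp') prev_next // eqxx.
exists (next p v), (prev p v); split=> //.
  move=> w wv wn wp; have [->|x0] := eqVneq (x [set v; w]) 0; first by left.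
  right; have [l lls el] := others w wv wn wp x0.
  by rewrite /one eq_sym wv (xl l) ?eqxx.
have [d [dv dn dp d0]] : exists d, [/\ d != v, d != next p v, d != prev p v & x [set v; d] != 0].
  have [/existsP[d /and4P[? ? ? ?]]|/existsPn H] := boolP [exists d, [&& d != v,
    d != next p v, d != prev p v & x [set v; d] != 0]]; first by exists d.
  have := x_sum v; case/andP: ha => va /eqP xa; case/andP: hb => vb /eqP xb.
  rewrite (bigD1 (next p v)) 1?eq_sym //= (bigD1 (prev p v)) /=; last by rewrite eq_sym vb eq_sym.
  rewrite xa xb big1; first lra.
  move=> w /andP[/andP[wv wn] wp]; have := H w; rewrite wv wn wp /= => /negPn/eqP//.
have [l lls el] := others d dv dn dp d0.
have [ul l1 l2] := lnk l lls.
have lp := lpath l lls.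
have vl : v \in link_vertices l.
  move: el; rewrite inE => /mapP[[a b]] /zip_rcons_in[ha' hb'] e.
  have : v \in [set a; b] by rewrite -e !inE eqxx.
  rewrite !inE => /orP[]/eqP->.
    by move: ha'; rewrite !inE mem_rcons inE => /orP[]->; rewrite ?orbT.
  by rewrite hb' orbT.
have : v \notin l.1.2.
  apply/negP => vq; move: un; rewrite cat_uniq => /and3P[_ /hasPn h _].
  have : v \in flatten [seq link_inner l | l <- ls].
    by apply/flattenP; exists (link_inner l) => //; apply/mapP; exists l.
  by move=> /h /=; rewrite vf.
move: vl; rewrite !inE mem_rcons inE => /or3P[/eqP e _|/eqP e _|->//].
  by exists l.1.2, l.2; rewrite e; split=> //; apply: fhalf.
exists (rev l.1.2), l.1.1; rewrite e.
have er : l.2 :: rcons (rev l.1.2) l.1.1 = rev (link_vertices l).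
  by rewrite /link_vertices rev_cons rev_rcons.
split.
- by rewrite er rev_uniq.
- have := rev_path one l.1.1 (rcons l.1.2 l.2).
  rewrite last_rcons belast_rcons rev_cons => ->.
  by rewrite (eq_path (e' := one)) // => a b; rewrite /= oneC.
- exact: fhalf.
Qed.

Lemma half_vertexP v : half v -> half_vertex v.
Proof.
move=> hv; case: (vertex_cases v) => // -[a [b [va vb ab]]].
by have := one_two_not_half va vb ab; rewrite hv.
Qed.

Lemma not_half_one v : ~~ half v -> one_vertex v.
Proof.
move=> hv; case: (vertex_cases v) => // -[a [b [va _ _ _ _]]].
by case/existsP: hv; exists a.
Qed.

Lemma half_one_uniq v a b : half v -> one v a -> one v b -> a = b.
Proof.
move=> hv va vb; apply/eqP; apply: contraT => ab.
by have := one_two_not_half va vb ab; rewrite hv.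
Qed.

Lemma hlf_one u v : hlf u v -> one u v -> False.
Proof. by move=> /andP[_ /eqP e] /andP[_ /eqP]; rewrite e => /eqP; rewrite (negPf half_neq1). Qed.

Lemma hlf_halfl u v : hlf u v -> half u.
Proof. by move=> h; apply/existsP; exists v. Qed.

Lemma hlf_halfr u v : hlf u v -> half v.
Proof. by rewrite hlfC; apply: hlf_halfl. Qed.

Lemma half_neighbours v : half v -> exists a b,
  [/\ hlf v a, hlf v b, a != b & forall w, hlf v w -> w = a \/ w = b].
Proof.
move=> /half_vertexP[a [b [va vb ab h _]]]; exists a, b; split=> // w vw.
have [->|wa] := eqVneq w a; first by left.
have [->|wb] := eqVneq w b; first by right.
case/andP: (vw) => nvw /eqP xw.
case: (h w _ wa wb) => [|x0|/(hlf_one vw)//]; first by rewrite eq_sym.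
by move: xw; rewrite x0 => /esym/eqP; rewrite mulf_eq0 oner_eq0 invr_eq0 pnatr_eq0.
Qed.

Lemma x_cases u v : u != v -> [\/ x [set u; v] = 0, one u v | hlf u v].
Proof.
move=> uv; have vu : v != u by rewrite eq_sym.
case: (vertex_cases u) => [[a [b [ua ub ab]]]|[a [b [ua ub ab h _]]]].
  have [->|va] := eqVneq v a; first by constructor 2.
  have [->|vb] := eqVneq v b; first by constructor 2.
  by constructor 1; apply: one_two ua ub ab _ va vb.
have [->|va] := eqVneq v a; first by constructor 3.
have [->|vb] := eqVneq v b; first by constructor 3.
by case: (h v vu va vb); [constructor 1 | constructor 2].
Qed.

Lemma path_closed (P : pred V) a p z : (forall v w, P v -> one v w -> P w) ->
  path one a p -> z \in a :: p -> P z -> {subset a :: p <= P}.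
Proof.
move=> cl; elim: p a z => [|b p IH] a z /=.
  by move=> _; rewrite inE => /eqP-> Pa v; rewrite inE => /eqP->.
move=> /andP[ab pb]; rewrite inE => /orP[/eqP->|zp] Pz.
  have Pb := cl _ _ Pz ab; move=> v; rewrite inE => /orP[/eqP-> //|].
  exact: (IH b b pb (mem_head _ _) Pb).
have H := IH b z pb zp Pz; move=> v; rewrite inE => /orP[/eqP->|/H //].
have Pb : P b := H b (mem_head _ _).
by apply: (cl b a Pb); rewrite oneC.
Qed.

Let I : finType := {v : V | half v}.
Implicit Types u : I.

(** * The paths between half vertices *)

Section Links.
Variable lk : I -> seq V * V.
Definition vs u := val u :: rcons (lk u).1 (lk u).2.
Hypothesis lkP : forall u,
  [/\ uniq (vs u), path one (val u) (rcons (lk u).1 (lk u).2) & half (lk u).2].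

Definition mate u : I := insubd u (lk u).2.

Lemma val_mate u : val (mate u) = (lk u).2.
Proof. by rewrite insubdK //; case: (lkP u). Qed.

(** A half vertex has one edge of value 1 and an inner vertex two, all of them on the path. So a
    path is a whole component of the edges of value 1, which is why two paths that meet are the
    same. *)
Lemma vs_closed u v w : v \in vs u -> one v w -> w \in vs u.
Proof.
have [un pt he] := lkP u; move: un pt; rewrite /vs.
set q := (lk u).1; set e := (lk u).2 => un pt.
rewrite inE mem_rcons inE => /or3P[/eqP->|/eqP->|vq] vw.
- move: pt un; case: (q) => [|b q'] /= /andP[ub _] _.
    by rewrite (half_one_uniq (valP u) vw ub) !inE eqxx orbT.
  by rewrite (half_one_uniq (valP u) vw ub) !inE eqxx orbT.
- move: pt; rewrite rcons_path => /andP[_]; rewrite oneC => el.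
  rewrite (half_one_uniq he vw el) -rcons_cons mem_rcons inE mem_last.
  by rewrite orbT.
- have [a [b [va vb ab ae be]]] := path_inner un pt vq.
  by case: (one_two_or va vb ab vw) => ->.
Qed.

Lemma vs_half u v : v \in vs u -> half v -> v = val u \/ v = val (mate u).
Proof.
have [un pt he] := lkP u; rewrite val_mate.
rewrite inE mem_rcons inE => /or3P[/eqP->|/eqP->|vq] hv; [by left | by right |].
have [a [b [va vb ab ae be]]] := path_inner un pt vq.
by have := one_two_not_half va vb ab; rewrite hv.
Qed.

Lemma vs_share u u' v : v \in vs u -> v \in vs u' ->
  {subset vs u' <= vs u} /\ (u' = u \/ u' = mate u).
Proof.
move=> vu vu'; have [_ pt _] := lkP u'.
have sub : {subset vs u' <= vs u}.
  by apply: (path_closed (z := v)) => // a b; apply: vs_closed.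
split=> //; have := vs_half (sub _ (mem_head _ _)) (valP u').
by case=> /val_inj; [left | right].
Qed.

Lemma mate_vs u : val (mate u) \in vs u.
Proof. by rewrite val_mate inE mem_rcons mem_head orbT. Qed.

Lemma mateN u : mate u != u.
Proof.
apply/eqP => e; have [] := lkP u; rewrite /vs -val_mate e /= => /andP[].
by rewrite mem_rcons mem_head.
Qed.

Lemma mateK : involutive mate.
Proof.
move=> u; have [sub _] := vs_share (mate_vs u) (mem_head _ _ : val (mate u) \in vs (mate u)).
case: (vs_half (sub _ (mate_vs (mate u))) (valP _)) => /val_inj // e.
by have := mateN (mate u); rewrite e eqxx.
Qed.

Definition len u := (size (lk u).1).+1.
Definition vtx u i := nth (val u) (vs u) i.
Definition ledge u i := [set vtx u i; vtx u i.+1].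

Lemma size_vs u : size (vs u) = (len u).+1.
Proof. by rewrite /= size_rcons. Qed.

Lemma vtx_one u i : (i < len u)%N -> one (vtx u i) (vtx u i.+1).
Proof.
by move=> il; have [_ /(pathP (val u)) h _] := lkP u; apply: h; rewrite size_rcons.
Qed.

Lemma vtx0 u : vtx u 0 = val u. Proof. by []. Qed.

Lemma vtx_len u : vtx u (len u) = val (mate u).
Proof. by rewrite val_mate /vtx /= nth_rcons ltnn eqxx. Qed.

Lemma vtx_in u i : (i <= len u)%N -> vtx u i \in vs u.
Proof. by move=> il; rewrite mem_nth // size_vs. Qed.

Lemma vsP u v : v \in vs u -> exists2 i, (i <= len u)%N & v = vtx u i.
Proof. by move=> /(nthP (val u))[i]; rewrite size_vs ltnS => il <-; exists i. Qed.

Lemma vtx_inj u i j : (i <= len u)%N -> (j <= len u)%N -> vtx u i = vtx u j -> i = j.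
Proof.
move=> il jl /eqP; rewrite nth_uniq ?size_vs //; first by move/eqP.
by have [] := lkP u.
Qed.

Lemma vtx_half u i : (i <= len u)%N -> half (vtx u i) -> i = 0%N \/ i = len u.
Proof.
move=> il /(vs_half (vtx_in il)); rewrite -vtx0 -vtx_len.
by case=> /vtx_inj e; [left | right]; apply: e.
Qed.

Lemma ledge_inj u i j : (i < len u)%N -> (j < len u)%N -> ledge u i = ledge u j -> i = j.
Proof.
move=> il jl /set2_eq[[/vtx_inj e _]|[/vtx_inj e1 /vtx_inj e2]]; first by apply: e; apply: ltnW.
by have := e1 (ltnW il) jl; have := e2 il (ltnW jl); lia.
Qed.

Lemma lead_mate u : lead mate u || lead mate (mate u).
Proof.
rewrite /lead mateK -neq_ltn; apply/eqP => /val_inj/enum_rank_inj e.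
by have := mateN u; rewrite -e eqxx.
Qed.

Lemma vs_lead_uniq u u' v : lead mate u -> lead mate u' -> v \in vs u -> v \in vs u' -> u' = u.
Proof.
move=> l l' vu vu'; have [_ [//|e]] := vs_share vu vu'.
by move: l'; rewrite e /lead mateK ltnNge (ltnW l).
Qed.

Lemma ledge_uniq u u' i j : lead mate u -> lead mate u' -> (i < len u)%N -> (j < len u')%N ->
  ledge u i = ledge u' j -> u' = u /\ j = i.
Proof.
move=> l l' il jl e; have uu : u' = u.
  have : vtx u i \in ledge u' j by rewrite -e !inE eqxx.
  have vi := vtx_in (ltnW il).
  by rewrite !inE => /orP[] /eqP h; apply: (vs_lead_uniq l l' vi); rewrite h vtx_in // ltnW.
by rewrite uu in jl e *; split=> //; apply: (ledge_inj jl il).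
Qed.

Variable nb : I -> bool -> I.
Hypothesis nbP : forall u, [/\ forall b, hlf (val u) (val (nb u b)), nb u true != nb u false
  & forall w, hlf (val u) w -> exists b, w = val (nb u b)].

(** The bit names the dart of the neighbour that leads back to [a.1]; as the two neighbours of a
    half vertex differ, one test decides it. *)
Definition ext (a : I * bool) : I * bool := (nb a.1 a.2, nb (nb a.1 a.2) true == a.1).

Lemma nb_ext a : nb (ext a).1 (ext a).2 = a.1.
Proof.
rewrite /ext /=; set v := nb a.1 a.2; have [_ _ h] := nbP v.
have [|b /val_inj e] := h (val a.1); first by rewrite hlfC; have [h1 _ _] := nbP a.1; apply: h1.
case: eqP => [//|ne]; case: b e => e; last exact: esym.
by case: ne; rewrite -e.
Qed.

Lemma extK : involutive ext.
Proof.
move=> [u b]; rewrite {1}/ext nb_ext /=; congr (_, _).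
case: b; first by rewrite eqxx.
by have [_ /negPf] := nbP u.
Qed.

Lemma extN a : ext a != a.
Proof.
apply/eqP => e; have [h _ _] := nbP a.1; have := h a.2.
by rewrite -[nb _ _]/(ext a).1 e /hlf eqxx.
Qed.

Lemma links_nocut (S : I -> bool) u0 : S (mate u0) != S u0 ->
  (forall a, S (ext a).1 = S a.1) ->
  (forall u, u != u0 -> u != mate u0 -> S (mate u) = S u) -> False.
Proof.
move=> S0 Se Sm.
(* The first edge e of the path of u0 is a cut edge: lab separates its ends and
   is constant along all other support edges. *)
pose lab v := if insub v is Some u then S u else if v \in vs u0 then S (mate u0)
  else if [pick u | v \in vs u] is Some u then S u else false.
have labI u : lab (val u) = S u by rewrite /lab valK.
have lab0 v : v \in vs u0 -> v != val u0 -> lab v = S (mate u0).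
  move=> v0 vu; rewrite /lab; case: insubP => [u hv e|_]; last by rewrite v0.
  have := vs_half v0 hv; rewrite -e => -[/val_inj e'|/val_inj -> //].
  by rewrite -e e' eqxx in vu.
have labu u v : u != u0 -> u != mate u0 -> v \in vs u -> lab v = S u.
  move=> uu0 um vu; rewrite /lab; case: insubP => [u' hv e|_].
    have := vs_half vu hv; rewrite -e => -[/val_inj -> //|/val_inj ->]; exact: Sm.
  case: ifP => [v0|_].
    by have [_ [e|e]] := vs_share v0 vu; rewrite e eqxx in uu0 um.
  case: pickP => [u' vu'|/(_ u)]; last by rewrite vu.
  by have [_ [->|->]] := vs_share vu vu'; rewrite ?Sm.
have labn v : (forall u, v \notin vs u) -> lab v = false.
  move=> h; rewrite /lab; case: insubP => [u _ e|_].
    by have := h u; rewrite -e mem_head.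
  by rewrite (negPf (h u0)); case: pickP => // u'; rewrite (negPf (h u')).
pose e := [set val u0; vtx u0 1].
have o1 : one (val u0) (vtx u0 1) := @vtx_one u0 0 isT.
have step a b : [set a; b] \in Defs.support x -> [set a; b] != e -> lab a = lab b.
  rewrite support2 => /andP[nab xab] ne.
  case: (x_cases nab) => [x0|oab|hab]; first by rewrite x0 ltxx in xab.
    have [/existsP[u au]|/existsPn na] := boolP [exists u, a \in vs u]; last first.
      rewrite !labn // => u; apply/negP => bu; have := na u.
      by rewrite (vs_closed bu) // oneC.
    have bu := vs_closed au oab.
    have [/andP[uu0 um]|] := boolP ((u != u0) && (u != mate u0)).
      by rewrite !(labu u).
    rewrite negb_and !negbK => uu.
    have sub : {subset vs u <= vs u0}.
      case/orP: uu => /eqP-> //.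
      by have [] := vs_share (mate_vs u0) (mem_head _ _ : val (mate u0) \in vs (mate u0)).
    have a0 : a != val u0.
      apply: contra ne => /eqP ea; move: oab; rewrite /e ea => oab.
      by rewrite (half_one_uniq (valP u0) oab o1).
    have b0 : b != val u0.
      apply: contra ne => /eqP ea; move: oab; rewrite /e ea oneC => oab.
      by rewrite (half_one_uniq (valP u0) oab o1) set2C.
    by rewrite !lab0 // sub.
  have [_ _ h] := nbP (Sub a (hlf_halfl hab)); have [d eb] := h b hab.
  pose u : I := Sub a (hlf_halfl hab).
  by rewrite eb -[a]/(val u) !labI -(Se (u, d)).
apply: (hcut (e := e)); exists (component (Defs.support x) (val u0)).
set C := component _ _.
have C0 : val u0 \in C := component_self _ _.
have Ck i : (i <= len u0)%N -> vtx u0 i \in C.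
  elim: i => [|i IH] il; first exact: C0.
  by apply: component_edge (one_support (vtx_one il)); apply: IH; apply: ltnW.
(* Every vertex of an integer component has two edges of value 1, which a half vertex cannot
   have. *)
have fC : fractional_component x C.
  case: (hx) => _ /(_ C (component_in _ _))[|//] /integer_vertex/(_ C0)[a [b [ha hb ab]]].
  by have := one_two_not_half ha hb ab; rewrite (valP u0).
split; first split.
- exact: component_in.
- by [].
- rewrite inE one_support //=; apply/subsetP => z; rewrite !inE => /orP[]/eqP->.
    by have := C0; rewrite !inE.
  by have := Ck 1%N isT; rewrite !inE.
- by case/andP: o1 => _ /eqP.
move=> conn; have := conn _ _ C0 (Ck _ (leqnn _)); rewrite vtx_len => /connectP[p pp pl].
have : lab (val u0) = lab (last (val u0) p).
  elim: p (val u0) pp {pl} => //= b p IH a /andP[ab pb].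
  by rewrite -(IH b pb); apply: step; move: ab; rewrite /adj /= in_setD1 => /andP[].
by rewrite -pl !labI => /esym/eqP; rewrite (negPf S0).
Qed.

(** * Costs of the three patterns *)

Hypothesis hc : forall e, e \in edges V -> 0 <= c e.

Definition link_sum u (f : nat -> R) : R := \sum_(i < len u) f i * c (ledge u i).
Definition pattern (r i : nat) : nat := if (i %% 3 == r)%N then 0 else 2.
Definition pcost u r := link_sum u (fun i => (pattern r i)%:R).

Lemma c_ledge u i : (i < len u)%N -> 0 <= c (ledge u i).
Proof. by move=> il; apply: hc; rewrite edges2; case/andP: (vtx_one il). Qed.

Lemma link_sum_le u f g : (forall i, (i < len u)%N -> f i <= g i) -> link_sum u f <= link_sum u g.
Proof. by move=> h; apply: ler_sum => i _; rewrite ler_wpM2r ?c_ledge ?h. Qed.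

Lemma link_sumD u f g : link_sum u f + link_sum u g = link_sum u (fun i => f i + g i).
Proof. by rewrite /link_sum -big_split; apply: eq_bigr => i _; rewrite mulrDl. Qed.

Lemma link_sumZ u k : link_sum u (fun=> k) = k * link_sum u (fun=> 1).
Proof. by rewrite /link_sum mulr_sumr; apply: eq_bigr => i _; rewrite mul1r. Qed.

Lemma pcost_pair u r r' : r != r' -> 2%:R * link_sum u (fun=> 1) <= pcost u r + pcost u r'.
Proof.
move=> rr; rewrite /pcost link_sumD -link_sumZ; apply: link_sum_le => i _.
rewrite -natrD ler_nat /pattern; case: (eqVneq (i %% 3)%N r) => [->|_]; last by lia.
by rewrite (negPf rr).
Qed.

Lemma pcost_three u : pcost u 0 + pcost u 1 + pcost u 2 = 4%:R * link_sum u (fun=> 1).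
Proof.
rewrite /pcost !link_sumD -link_sumZ; apply: eq_bigr => i _; congr (_ * _).
rewrite -!natrD /pattern; have : (i %% 3 < 3)%N by rewrite ltn_mod.
by case: (i %% 3)%N => [|[|[|]]].
Qed.

Lemma lead_mateN u : lead mate (mate u) = ~~ lead mate u.
Proof.
have := lead_mate u; rewrite /lead mateK; case: ltngtP => // /val_inj/enum_rank_inj e.
Qed.

(** [lk u] and [lk (mate u)] are chosen independently, so the edges of a path are always indexed
    along the list of one fixed end. *)
Definition rep u := if lead mate u then u else mate u.

Lemma rep_mate u : rep (mate u) = rep u.
Proof. by rewrite /rep lead_mateN mateK; case: (lead mate u). Qed.

(* For type I, cov u is the residue other than 2 and len u mod 3, those of the
   patterns for a start, resp. an end, without cycle edges. *)
Definition cov u := if (len u %% 3 == 2)%N then (if pcost u 0 <= pcost u 1 then 0%N else 1%N)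
                    else (1 - len u %% 3)%N.

Definition gP u := link_sum (rep u) (fun=> 1).
Definition gA0 u := pcost (rep u) (cov (rep u)).
(** The first two edges have indices 0 and 1, so dropping residue 2 keeps them. The last two have
    indices len - 1 and len - 2, so the residue to drop for the far end is that of len - 3, which is
    len mod 3. *)
Definition gA u := if lead mate u then pcost u 2 else pcost (mate u) (len (mate u) %% 3)%N.
Definition gty u := (len (rep u) %% 3 == 2)%N.
Definition hedge (a : I * bool) := [set val a.1; val (nb a.1 a.2)].

Lemma gA_pair u : gA u + gA (mate u) = pcost (rep u) 2 + pcost (rep u) (len (rep u) %% 3)%N.
Proof.
rewrite /gA lead_mateN mateK /rep; case: (lead mate u) => //=; exact: addrC.
Qed.

Lemma gA_I u : ~~ gty u -> 2%:R * gP u <= gA u + gA (mate u) /\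
  gA0 u + gA u + gA (mate u) = 4%:R * gP u.
Proof.
rewrite /gty => tu; rewrite -addrA gA_pair /gA0 /gP; split.
  by apply: pcost_pair; rewrite eq_sym.
rewrite -pcost_three /cov (negPf tu); have : (len (rep u) %% 3 < 3)%N by rewrite ltn_mod.
move: tu; case: (len (rep u) %% 3)%N => [|[|[|]]] //= _ _.
  by rewrite subn0; ring.
by rewrite subnn; ring.
Qed.

Lemma gA_II u : gty u -> [/\ gA (mate u) = gA u, 2%:R * gA0 u + gA u <= 4%:R * gP u
  & 2%:R * gP u <= gA u + gA0 u].
Proof.
rewrite /gty => tu; have eA v : rep v = rep u -> gA v = pcost (rep u) 2.
  move=> e; rewrite /gA; move: (e); rewrite {1}/rep; case: (lead mate v) => e1.
    by rewrite e1.
  by rewrite e1 (eqP tu).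
rewrite !eA ?rep_mate // /gA0 /gP /cov tu; split=> //.
  by rewrite -pcost_three; case: (leP (pcost (rep u) 0) (pcost (rep u) 1)) => h; lra.
by apply: pcost_pair; case: ifP.
Qed.

Lemma gadget_links : exists N : I * bool -> bool, [/\
  forall a, N (ext a) = N a,
  forall u, if gty u then ncount N (mate u) = ncount N u
    else (ncount N u + ncount N (mate u) = 2)%N \/
         (ncount N u = 0%N /\ ncount N (mate u) = 0%N)
  & \sum_u ((~~ N (u, true))%:R * c (hedge (u, true)) + (~~ N (u, false))%:R * c (hedge (u, false))
            + path_cost mate gP gA0 gA N u)
    <= \sum_u (5%:R / 9%:R * (c (hedge (u, true)) + c (hedge (u, false))) + 10%:R / 9%:R * gP u)].
Proof.
apply: (@gadget R I mate ext gty _ _ _ _ _ _ gP gA0 gA (fun a => c (hedge a))).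
- exact: mateK.
- exact: mateN.
- exact: extK.
- exact: extN.
- by move=> u; rewrite /gty rep_mate.
- exact: links_nocut.
- by move=> u; rewrite /gP rep_mate.
- by move=> u; rewrite /gA0 rep_mate.
- exact: gA_I.
- exact: gA_II.
Qed.

(** * The graphical 2-matching and its degrees *)

Section Multiplicity.
Variable N : I * bool -> bool.
Hypothesis N_ext : forall a, N (ext a) = N a.
Hypothesis N_states : forall u, if gty u then ncount N (mate u) = ncount N u
  else (ncount N u + ncount N (mate u) = 2)%N \/
       (ncount N u = 0%N /\ ncount N (mate u) = 0%N).

Definition residue u := if ncount N u == 2%N then 2%N
  else if ncount N (mate u) == 2%N then (len u %% 3)%N else cov u.
Definition lmult u i := if ncount N u == 1%N then 1%N else pattern (residue u) i.
Definition owned e := [exists u, lead mate u && [exists i : 'I_(len u), e == ledge u i]].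

(** The double sum is a lookup: by [ledge_uniq] at most one of its terms concerns e. Edges of value
    1 on no path, those of the integer components, are used once. *)
Definition mult (e : {set V}) : nat :=
  if e \in edges V then
    if x e == 1 / 2%:R then nat_of_bool (~~ [exists a, (e == hedge a) && N a])
    else if x e == 1 then
      if owned e then (\sum_(u | lead mate u) \sum_(i < len u) (ledge u i == e) * lmult u i)%N
      else 1%N
    else 0%N
  else 0%N.

Lemma hedge_hlf a : hlf (val a.1) (val (nb a.1 a.2)).
Proof. by have [h _ _] := nbP a.1. Qed.

Lemma hedge_inj a b : hedge a = hedge b -> a = b \/ a = ext b.
Proof.
case: a b => [u d] [v d'] /set2_eq[[/val_inj /= e1 /val_inj /= e2]|[/val_inj /= e1 /val_inj /= e2]].
  left; rewrite e1 in e2 *; congr (_, _).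
  have [_ ne _] := nbP v; move: e2; case: d; case: d' => // e; by rewrite e eqxx in ne.
right; rewrite /ext /= e1; congr (_, _); rewrite -e1 -e2; case: d e2 => [_|e2]; first by rewrite eqxx.
by apply/esym/negbTE; have [_ ne _] := nbP u.
Qed.

Lemma hedge_ext a : hedge (ext a) = hedge a.
Proof. by rewrite /hedge nb_ext set2C. Qed.

Lemma mult_hedge a : mult (hedge a) = ~~ N a :> nat.
Proof.
have /andP[ne /eqP xa] := hedge_hlf a.
rewrite /mult edges2 ne xa eqxx; congr (~~ _ : nat).
apply/existsP/idP => [[b /andP[/eqP /hedge_inj[->//|->]]]|Na]; last by exists a; rewrite eqxx.
by rewrite N_ext.
Qed.

Lemma mult0 (u v : V) : x [set u; v] = 0 -> mult [set u; v] = 0%N.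
Proof.
move=> x0; rewrite /mult x0 eq_sym mulf_eq0 oner_eq0 invr_eq0 pnatr_eq0 /=.
by rewrite eq_sym oner_eq0; case: ifP.
Qed.

Lemma one_mult (u v : V) : one u v -> mult [set u; v] =
  if owned [set u; v] then
    (\sum_(u' | lead mate u') \sum_(i < len u') (ledge u' i == [set u; v]) * lmult u' i)%N
  else 1%N.
Proof.
move=> /andP[ne /eqP xa]; rewrite /mult edges2 ne xa eqxx eq_sym.
by rewrite (negPf half_neq1).
Qed.

Lemma mult_ledge u i : lead mate u -> (i < len u)%N -> mult (ledge u i) = lmult u i.
Proof.
move=> lu il; rewrite one_mult; last exact: vtx_one.
rewrite ifT; last by apply/existsP; exists u; rewrite lu; apply/existsP; exists (Ordinal il).
rewrite (bigD1 u) //= (bigD1 (Ordinal il)) //= eqxx mul1n big1 => [|j ji].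
  rewrite addn0 big1 ?addn0 // => v /andP[lv vu]; rewrite big1 // => j _.
  case: eqP => // e; have [e' _] := ledge_uniq lv lu (ltn_ord j) il e.
  by rewrite e' eqxx in vu.
case: eqP => // e; have e' := ledge_inj (ltn_ord j) il e.
by case/eqP: ji; apply: val_inj.
Qed.

Lemma mult_free (u v : V) : one u v -> (forall w, u \notin vs w) -> mult [set u; v] = 1%N.
Proof.
move=> uv un; rewrite one_mult // ifF //; apply/negbTE/negP.
move=> /existsP[w /andP[_ /existsP[i /eqP e]]].
have : u \in ledge w i by rewrite -e !inE eqxx.
by rewrite !inE => /orP[]/eqP h; have := un w; rewrite h vtx_in // ltnW.
Qed.

Lemma ncount_le2 u : (ncount N u <= 2)%N.
Proof. by rewrite /ncount; case: (N (u, true)); case: (N (u, false)). Qed.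

Lemma lmult_le2 u i : (lmult u i <= 2)%N.
Proof. by rewrite /lmult /pattern; case: ifP => // _; case: ifP. Qed.

Lemma lead_states u : lead mate u -> let n := ncount N u in let n' := ncount N (mate u) in
  [\/ n = 1 /\ n' = 1, n = 0 /\ n' = 0,
      n = 2 /\ n' = (if len u %% 3 == 2 then 2 else 0)
    | n = 0 /\ (n' = 2 /\ (len u %% 3 != 2))]%N.
Proof.
move=> lu /=; have := N_states u; rewrite /gty /rep lu.
have := ncount_le2 u; have := ncount_le2 (mate u).
case: ifP => l3; move: (ncount N u) (ncount N (mate u)) => n n' h1 h2.
  move=> e; subst n'; case: n {h1} h2 => [|[|[|]]] // _.
  - by constructor 2.
  - by constructor 1.
  - by constructor 3.
move=> [e|[-> ->]]; last by constructor 2.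
case: n e {h2} => [|[|[|]]] //= e.
- by constructor 4; split=> //; split=> //; lia.
- by constructor 1; split=> //; lia.
- by constructor 3; split=> //; lia.
Qed.

Lemma residue_start u : ncount N u = 2%N -> residue u = 2%N.
Proof. by move=> e; rewrite /residue e. Qed.

(** If both ends lose both cycle edges, [residue] takes its first branch; the path is then of type
    II and len mod 3 is 2 as well. *)
Lemma residue_end u : lead mate u -> ncount N (mate u) = 2%N -> residue u = (len u %% 3)%N.
Proof.
move=> lu e; rewrite /residue e; case: eqP => // e2.
by case: (lead_states lu) => -[]; rewrite ?e ?e2 //; case: eqP => // ->.
Qed.

Lemma mult_le2 e : (mult e <= 2)%N.
Proof.
have [|ne] := boolP (e \in edges V); last by rewrite /mult (negPf ne).
move=> /edgesP[u [v [uv ->]]]; case: (x_cases uv) => [/mult0->//|o|h].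
  have [/existsP[w /andP[lw /existsP[i /eqP->]]]|no] := boolP (owned [set u; v]).
    by rewrite mult_ledge // lmult_le2.
  by rewrite one_mult // (negPf no).
have [_ _ H] := nbP (Sub u (hlf_halfl h)); have [d ->] := H v h.
by have := mult_hedge (Sub u (hlf_halfl h), d); rewrite /hedge /= => ->; case: (N _).
Qed.

Lemma degree_one v a b : one v a -> one v b -> a != b ->
  (\sum_(e in delta v) mult e = mult [set v; a] + mult [set v; b])%N.
Proof.
move=> va vb ab; rewrite big_delta (bigD1 a) /=; last by rewrite eq_sym; case/andP: va.
rewrite (bigD1 b) /=; last by rewrite eq_sym; case/andP: vb => -> _; rewrite eq_sym.
rewrite big1 ?addn0 // => w /andP[/andP[wv wa] wb].
by rewrite mult0 // (one_two va vb ab).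
Qed.

Lemma nb_neq u : val (nb u true) != val (nb u false).
Proof. by have [_ ne _] := nbP u; rewrite (inj_eq val_inj). Qed.

Lemma degree_half u d : one (val u) d ->
  (\sum_(e in delta (val u)) mult e = (2 - ncount N u) + mult [set val u; d])%N.
Proof.
move=> ud; have ha := hedge_hlf (u, true); have hb := hedge_hlf (u, false); rewrite /= in ha hb.
have ad : val (nb u true) != d by apply/eqP => e; rewrite e in ha; exact: hlf_one ha ud.
have bd : val (nb u false) != d by apply/eqP => e; rewrite e in hb; exact: hlf_one hb ud.
have [ua ub du] : [/\ val (nb u true) != val u, val (nb u false) != val u & d != val u].
  by rewrite ![_ == val u]eq_sym; case/andP: ha; case/andP: hb; case/andP: ud.
rewrite big_delta (bigD1 (val (nb u true))) //= (bigD1 (val (nb u false))) /=; last first.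
  by rewrite ub eq_sym nb_neq.
rewrite (bigD1 d) /=; last by rewrite du eq_sym ad eq_sym bd.
rewrite big1 => [|w /andP[/andP[/andP[wv wa] wb] wd]].
  rewrite -/(hedge (u, true)) -/(hedge (u, false)) !mult_hedge /ncount.
  by case: (N (u, true)); case: (N (u, false)); rewrite ?addn0 ?add0n.
have vw : val u != w by rewrite eq_sym.
case: (x_cases vw) => [/mult0//|o|h].
  by rewrite (half_one_uniq (valP u) o ud) eqxx in wd.
by have [_ _ /(_ w h)[[] e]] := nbP u; rewrite e eqxx in wa wb.
Qed.

Lemma pattern_cases r i : pattern r i = 0%N \/ pattern r i = 2%N.
Proof. by rewrite /pattern; case: ifP; [left | right]. Qed.

(** Dropped indices are three apart, so two consecutive edges never vanish together. *)
Lemma lmult_step u i : (lmult u i + lmult u i.+1 = 2 \/ lmult u i + lmult u i.+1 = 4)%N.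
Proof.
rewrite /lmult; case: ifP => _; first by left.
rewrite /pattern; case: eqP => [<-|_]; last by case: ifP; [left | right].
by left; rewrite ifF //; apply/negbTE/eqP; lia.
Qed.

Lemma on_lead v u : v \in vs u -> exists2 w, lead mate w & v \in vs w.
Proof.
move=> vu; case/orP: (lead_mate u) => l; first by exists u.
exists (mate u) => //; have mu : val (mate u) \in vs (mate u) := mem_head _ _.
by have [sub _] := vs_share mu (mate_vs u); apply: sub.
Qed.

Lemma start_degree u : ((2 - ncount N u) + lmult u 0 = 2 \/ (2 - ncount N u) + lmult u 0 = 4)%N.
Proof.
have := ncount_le2 u; rewrite /lmult; case e : (ncount N u) => [|[|[|]]] //= _.
- by case: (pattern_cases (residue u) 0) => ->; [left | right].
- by left.
- by left; rewrite residue_start.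
Qed.

Lemma end_degree u : lead mate u -> ((2 - ncount N (mate u)) + lmult u (len u).-1 = 2 \/
  (2 - ncount N (mate u)) + lmult u (len u).-1 = 4)%N.
Proof.
move=> lu; have r := residue_end lu; rewrite /lmult.
have l3 : pattern (len u %% 3) (len u).-1 = 2%N.
  by rewrite /pattern ifF //; apply/negbTE/eqP; have : (0 < len u)%N by []; lia.
have pc := pattern_cases (residue u) (len u).-1.
case: (lead_states lu) => -[e]; [move=> e'|move=> e'|move=> e'|move=> [e' _]]; rewrite e ?e' /=.
- by left.
- by case: pc => ->; [left | right].
- case: eqP e' => _ e' /=; first by left; rewrite r.
  by case: pc => ->; [left | right].
- by left; rewrite r.
Qed.

Lemma mult_degree v : (\sum_(e in delta v) mult e = 2)%N \/ (\sum_(e in delta v) mult e = 4)%N.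
Proof.
have [/existsP[u0 vu0]|/existsPn nv] := boolP [exists u, v \in vs u]; last first.
  have [|a [b [va vb ab]]] := @not_half_one v.
    by apply/negP => h; have := nv (Sub v h); rewrite mem_head.
  by left; rewrite (degree_one va vb ab) !mult_free.
have [u lu vu] := on_lead vu0; have [i il ev] := vsP vu.
have l0 : (0 < len u)%N by [].
have [i0|i0] := posnP i.
  have o : one (val u) (vtx u 1) := vtx_one l0.
  rewrite ev i0 vtx0 (degree_half o) (mult_ledge lu l0 : mult [set val u; vtx u 1] = _).
  exact: start_degree.
have pl : ((len u).-1 < len u)%N by [].
have [ik|ik] := eqVneq i (len u).
  have := vtx_one pl; rewrite prednK // vtx_len oneC => o.
  rewrite ev ik vtx_len (degree_half o) set2C -vtx_len.
  rewrite (_ : [set _; _] = ledge u (len u).-1) ?mult_ledge //; exact: end_degree.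
have {ik}il : (i < len u)%N by rewrite ltn_neqAle ik.
have o1 := vtx_one (leq_ltn_trans (leq_pred i) il); rewrite prednK // oneC in o1.
rewrite ev (degree_one o1 (vtx_one il)).
  rewrite set2C (_ : [set vtx u i.-1; _] = ledge u i.-1); last by rewrite /ledge prednK.
  rewrite !mult_ledge //; last by apply: leq_ltn_trans il; apply: leq_pred.
  by have := lmult_step u i.-1; rewrite prednK.
apply/eqP => /vtx_inj e; suff : i.-1 = i.+1 by lia.
by apply: e => //; lia.
Qed.

(** * Every component has at least three vertices *)

Let M : {set {set V}} := [set e : {set V} | (0 < mult e)%N].

Lemma three_connected v a b : connect (adj M) v a -> connect (adj M) v b ->
  a != v -> b != v -> a != b -> (3 <= #|component M v|)%N.
Proof.
move=> va vb av bv ab.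
have <- : #|[set v; a; b]| = 3%N by rewrite -setUA !cardsU1 !inE negb_or !(eq_sym v) av bv ab cards1.
by apply/subset_leq_card/subsetP => w; rewrite !inE => /orP[/orP[]|] /eqP->; rewrite ?connect0.
Qed.

Lemma adjM (a b : V) : adj M a b = (0 < mult [set a; b])%N.
Proof. by rewrite /adj /= inE. Qed.

Lemma adjMC (a b : V) : adj M a b = adj M b a.
Proof. by rewrite !adjM set2C. Qed.

Lemma adj_nb u b : ~~ N (u, b) -> adj M (val u) (val (nb u b)).
Proof. by move=> h; rewrite adjM -/(hedge (u, b)) mult_hedge h. Qed.

Lemma half_adj u : ncount N u != 2%N -> exists2 z, hlf (val u) z & adj M (val u) z.
Proof.
rewrite /ncount; have ha := hedge_hlf (u, true); have hb := hedge_hlf (u, false).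
case nt : (N (u, true)); last by exists (val (nb u true)); rewrite ?adj_nb ?nt.
case nf : (N (u, false)) => // _; by exists (val (nb u false)); rewrite ?adj_nb ?nf.
Qed.

Lemma lmult_gt0 u i : (0 < lmult u i)%N = (ncount N u == 1%N) || (i %% 3 != residue u)%N.
Proof. by rewrite /lmult /pattern; case: ifP => //= _; case: eqP. Qed.

Lemma adj_link u i : lead mate u -> (i < len u)%N ->
  adj M (vtx u i) (vtx u i.+1) = (0 < lmult u i)%N.
Proof. by move=> lu il; rewrite adjM mult_ledge. Qed.

Lemma half_component u d : one (val u) d -> ncount N u != 2%N ->
  (ncount N u = 1%N -> adj M (val u) d) -> (3 <= #|component M (val u)|)%N.
Proof.
move=> o n2 h; have /= ha := hedge_hlf (u, true); have /= hb := hedge_hlf (u, false).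
have [n0|n0] := eqVneq (ncount N u) 0%N.
  have [nt nf] : ~~ N (u, true) /\ ~~ N (u, false).
    by move: n0; rewrite /ncount; case: (N (u, true)); case: (N (u, false)).
  apply: (three_connected (connect1 (adj_nb nt)) (connect1 (adj_nb nf))).
  - by rewrite eq_sym; case/andP: ha.
  - by rewrite eq_sym; case/andP: hb.
  - exact: nb_neq.
have n1 : ncount N u = 1%N by have := ncount_le2 u; lia.
have [z hz az] := half_adj n2.
apply: (three_connected (connect1 az) (connect1 (h n1))).
- by rewrite eq_sym; case/andP: hz.
- by rewrite eq_sym; case/andP: o.
- by apply/eqP => e; rewrite e in hz; exact: hlf_one hz o.
Qed.

(** On either side of a dropped edge the next two path edges are kept, unless the path ends before.
    In that case the half vertex at that end still has a cycle edge, because an end without cycle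
    edges has the path edges next to it doubled, up to two of them. *)
Lemma link_component u i : lead mate u -> (i <= len u)%N -> (3 <= #|component M (vtx u i)|)%N.
Proof.
move=> lu il; have l0 : (0 < len u)%N by [].
have pl : ((len u).-1 < len u)%N by [].
have vneq j k : (j <= len u)%N -> (k <= len u)%N -> j != k -> vtx u j != vtx u k.
  by move=> jl kl; apply: contraNneq => /vtx_inj->.
have nst : ncount N u = 2%N -> residue u = 2%N := residue_start (u := u).
have nen : ncount N (mate u) = 2%N -> residue u = (len u %% 3)%N := residue_end lu.
have n11 : (ncount N u == 1%N) = (ncount N (mate u) == 1%N).
  by case: (lead_states lu) => -[-> e]; [rewrite e | rewrite e | rewrite e; case: ifP | case: e => ->].
(* A path of one edge is of type I, so its two ends cannot both lose their cycle edges and leave a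
   component of two vertices. *)
have n20 : len u = 1%N -> ncount N u = 2%N -> ncount N (mate u) != 2%N.
  by move=> l1 n2; case: (lead_states lu) => -[]; rewrite n2 // => _ ->; rewrite l1.
have len1 : len u = 1%N -> vtx u 1 = val (mate u) by move=> l1; rewrite -vtx_len l1.
have [->|i0] := posnP i.
  have [n2|n2] := eqVneq (ncount N u) 2%N; last first.
    rewrite vtx0; apply: (half_component (vtx_one l0)) => // n1.
    by rewrite -vtx0 adj_link // lmult_gt0 n1.
  have a0 : adj M (vtx u 0) (vtx u 1) by rewrite adj_link // lmult_gt0 nst // orbT.
  have [l1|l1] := eqVneq (len u) 1%N.
    have [z hz az] := half_adj (n20 l1 n2).
    apply: (three_connected (connect1 a0) (b := z)).
    + by apply: connect_trans (connect1 a0) _; rewrite len1 // connect1.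
    + by rewrite vneq.
    + apply/eqP => e; have := vtx_one l0; rewrite oneC len1 // -e.
      exact: hlf_one hz.
    + by rewrite len1 //; case/andP: hz.
  have l2 : (1 < len u)%N by lia.
  have a1 : adj M (vtx u 1) (vtx u 2) by rewrite adj_link // lmult_gt0 nst // orbT.
  apply: (three_connected (connect1 a0) (connect_trans (connect1 a0) (connect1 a1)));
    by rewrite vneq.
have [->|ik] := eqVneq i (len u).
  have o := vtx_one pl; rewrite prednK // vtx_len oneC in o.
  have [n2|n2] := eqVneq (ncount N (mate u)) 2%N; last first.
    rewrite vtx_len; apply: (half_component o) => // n1.
    rewrite adjMC -vtx_len -[in X in adj M _ (vtx u X)](prednK l0) adj_link // lmult_gt0.
    by rewrite n11 n1.
  have a0 : adj M (vtx u (len u)) (vtx u (len u).-1).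
    rewrite adjMC -[in X in adj M _ (vtx u X)](prednK l0) adj_link // lmult_gt0 nen //.
    apply/orP; right; lia.
  have [l1|l1] := eqVneq (len u) 1%N.
    have n2' : ncount N u != 2%N by apply/eqP => /(n20 l1); rewrite n2.
    have [z hz az] := half_adj n2'.
    have e0 : vtx u (len u).-1 = val u by rewrite l1 vtx0.
    apply: (three_connected (connect1 a0) (b := z)).
    + by apply: connect_trans (connect1 a0) _; rewrite e0 connect1.
    + by rewrite vneq // l1.
    + apply/eqP => e; rewrite vtx_len in e; have := vtx_one l0; rewrite len1 // -e.
      exact: hlf_one hz.
    + by rewrite e0; case/andP: hz.
  have l2 : ((len u).-2.+1 = (len u).-1)%N by lia.
  have a1 : adj M (vtx u (len u).-1) (vtx u (len u).-2).
    rewrite adjMC -l2 adj_link //; last by lia.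
    rewrite lmult_gt0 nen //; apply/orP; right; lia.
  apply: (three_connected (connect1 a0) (connect_trans (connect1 a0) (connect1 a1)));
    by rewrite vneq //; lia.
have {ik}il : (i < len u)%N by rewrite ltn_neqAle ik.
have ei : i.-1.+1 = i by rewrite prednK.
have il1 : (i.-1 < len u)%N by lia.
have nh : ~~ half (vtx u i) by apply/negP => /(vtx_half (ltnW il)) []; lia.
have dn : adj M (vtx u i) (vtx u i.-1) = (0 < lmult u i.-1)%N by rewrite adjMC -adj_link // ei.
have up := adj_link lu il.
have [p1|p1] := boolP (0 < lmult u i.-1)%N; have [p2|p2] := boolP (0 < lmult u i)%N.
- rewrite p1 in dn; rewrite p2 in up.
  by apply: (three_connected (connect1 dn) (connect1 up)); rewrite vneq //; lia.
- rewrite p1 in dn; move: p2; rewrite lmult_gt0 negb_or negbK => /andP[n1 /eqP r].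
  have [i1|i1] := eqVneq i 1%N.
    have n2 : ncount N u != 2%N by apply/eqP => /nst; rewrite -r i1.
    have [z hz az] := half_adj n2; have e0 : vtx u i.-1 = val u by rewrite i1.
    apply: (three_connected (connect1 dn) (b := z)).
    + by apply: connect_trans (connect1 dn) _; rewrite e0 connect1.
    + by rewrite vneq //; lia.
    + by apply: contraNneq nh => <-; apply: hlf_halfr hz.
    + by rewrite e0; case/andP: hz.
  have e2 : i.-2.+1 = i.-1 by lia.
  have a1 : adj M (vtx u i.-1) (vtx u i.-2).
    rewrite adjMC -e2 adj_link //; last by lia.
    by rewrite lmult_gt0 -r; apply/orP; right; lia.
  by apply: (three_connected (connect1 dn) (connect_trans (connect1 dn) (connect1 a1)));
    rewrite vneq //; lia.
- rewrite p2 in up; move: p1; rewrite lmult_gt0 negb_or negbK => /andP[n1 /eqP r].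
  have [i1|i1] := eqVneq i.+1 (len u).
    have n2 : ncount N (mate u) != 2%N by apply/eqP => /nen; rewrite -r -i1; lia.
    have [z hz az] := half_adj n2; have e0 : vtx u i.+1 = val (mate u) by rewrite i1 vtx_len.
    apply: (three_connected (connect1 up) (b := z)).
    + by apply: connect_trans (connect1 up) _; rewrite e0 connect1.
    + by rewrite vneq //; lia.
    + by apply: contraNneq nh => <-; apply: hlf_halfr hz.
    + by rewrite e0; case/andP: hz.
  have il2 : (i.+1 < len u)%N by lia.
  have a1 : adj M (vtx u i.+1) (vtx u i.+2).
    rewrite adj_link // lmult_gt0 -r; apply/orP; right; lia.
  by apply: (three_connected (connect1 up) (connect_trans (connect1 up) (connect1 a1)));
    rewrite vneq //; lia.
- exfalso; move: p1 p2; rewrite !lmult_gt0 !negb_or !negbK => /andP[_ /eqP r] /andP[_ /eqP r'].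
  lia.
Qed.

Lemma mult_component v : (3 <= #|component M v|)%N.
Proof.
have [/existsP[u0 vu0]|/existsPn nv] := boolP [exists u, v \in vs u].
  have [u lu vu] := on_lead vu0; have [i il ->] := vsP vu; exact: link_component.
have [|a [b [va vb ab]]] := @not_half_one v.
  by apply/negP => h; have := nv (Sub v h); rewrite mem_head.
apply: (@three_connected v a b) => //.
- by rewrite connect1 // adjM mult_free.
- by rewrite connect1 // adjM mult_free.
- by rewrite eq_sym; case/andP: va.
- by rewrite eq_sym; case/andP: vb.
Qed.

Lemma mult_G2M : G2M mult.
Proof.
split.
- by move=> e; rewrite /mult; case: ifP.
- exact: mult_le2.
- exact: mult_degree.
- by move=> C /imsetP[v _ ->]; apply: mult_component.
Qed.

(** * The cost of the graphical 2-matching *)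

Lemma hedge_sum (F : {set V} -> R) :
  \sum_a F (hedge a) = 2%:R * \sum_(e in edges V | x e == 1 / 2%:R) F e.
Proof.
rewrite (big_involution _ _ extK extN) /=.
rewrite (eq_bigr (fun a => 2%:R * F (hedge a))) => [|a _]; last first.
  by rewrite hedge_ext mulrDl mul1r.
rewrite -mulr_sumr; congr (_ * _).
rewrite (eq_bigl (fun a => a \in [set a | lead ext a])) => [|a]; last by rewrite inE.
rewrite -(big_imset F (h := hedge)) /=; last first.
  move=> a b; rewrite !inE => la lb /hedge_inj[] // e.
  by move: la; rewrite e /lead extK ltnNge (ltnW lb).
apply: eq_bigl => e; apply/imsetP/andP => [[a _ ->]|[/edgesP[u [v [uv ->]]] xe]].
  by have /andP[h1 h2] := hedge_hlf a; rewrite edges2 h1.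
have h : hlf u v by rewrite /hlf uv.
have [_ _ H] := nbP (Sub u (hlf_halfl h)); have [d ->] := H v h.
pose a : I * bool := (Sub u (hlf_halfl h), d).
have [la|la] := boolP (lead ext a); first by exists a; rewrite ?inE.
exists (ext a); last by rewrite hedge_ext.
rewrite inE; move: la; rewrite /lead extK -leqNgt leq_eqVlt => /orP[/eqP/val_inj/enum_rank_inj ea|//].
by have := extN a; rewrite ea eqxx.
Qed.

Lemma owned_sum (F : {set V} -> R) :
  \sum_(e | owned e) F e = \sum_(u | lead mate u) \sum_(i < len u) F (ledge u i).
Proof.
rewrite (eq_bigr (fun e => \sum_(u | lead mate u) \sum_(i < len u) (ledge u i == e)%:R * F e)).
  rewrite exchange_big /=; apply: eq_bigr => u lu; rewrite exchange_big /=.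
  apply: eq_bigr => i _; rewrite (bigD1 (ledge u i)) /=; last first.
    by apply/existsP; exists u; rewrite lu; apply/existsP; exists i.
  rewrite eqxx mul1r big1 ?addr0 // => e /andP[_ /negPf ne].
  by rewrite eq_sym ne mul0r.
move=> e /existsP[u /andP[lu /existsP[i /eqP->]]].
rewrite (bigD1 u) //= (bigD1 i) //= eqxx mul1r big1 => [|j ji].
  rewrite addr0 big1 ?addr0 // => v /andP[lv vu]; rewrite big1 // => j _.
  case: eqP => [e'|_]; last by rewrite mul0r.
  have [e'' _] := ledge_uniq lv lu (ltn_ord j) (ltn_ord i) e'.
  by rewrite e'' eqxx in vu.
case: eqP => [e'|_]; last by rewrite mul0r.
by case/eqP: ji; apply: val_inj; apply: (ledge_inj (ltn_ord j) (ltn_ord i)).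
Qed.

Lemma edge_sum (F : {set V} -> R) : (forall e, e \in edges V -> x e = 0 -> F e = 0) ->
  \sum_(e in edges V) F e = (\sum_a F (hedge a)) / 2%:R +
    \sum_(u | lead mate u) \sum_(i < len u) F (ledge u i) +
    \sum_(e in edges V | (x e == 1) && ~~ owned e) F e.
Proof.
move=> F0; rewrite hedge_sum mulrC mulKf ?pnatr_eq0 // -addrA.
rewrite (bigID (fun e => x e == 1 / 2%:R)) /=; congr (_ + _).
rewrite (bigID owned) /= -(owned_sum F); congr (_ + _).
  apply: eq_bigl => e; apply/idP/idP => [/andP[]//|oe]; rewrite oe andbT.
  case/existsP: oe => u /andP[lu /existsP[i /eqP->]].
  by have /andP[ne /eqP ->] := vtx_one (ltn_ord i); rewrite edges2 ne eq_sym half_neq1.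
rewrite big_mkcond [RHS]big_mkcond; apply: eq_bigr => e _.
have [eE|//] := boolP (e \in edges V) => /=; case: (owned e); rewrite ?andbF //= !andbT.
have := F0 e eE; case/edgesP: eE => u [v [uv ->]] F0e.
case: (x_cases uv) => [x0|/andP[_ /eqP->]|/andP[_ /eqP->]].
- by rewrite x0 (F0e x0); do 2 case: ifP.
- by rewrite eqxx eq_sym half_neq1.
- by rewrite eqxx (negPf half_neq1).
Qed.

Lemma lead_path_cost u : lead mate u ->
  path_cost mate gP gA0 gA N u = link_sum u (fun i => (lmult u i)%:R).
Proof.
move=> lu; rewrite /path_cost /lmult /residue /gP /gA0 /gA lead_mateN mateK /rep lu /=.
by case: eqP => [_|_]; last case: eqP => [_|_]; last case: eqP.
Qed.

Lemma path_cost_mate u : path_cost mate gP gA0 gA N (mate u) = path_cost mate gP gA0 gA N u.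
Proof.
have := N_states u; rewrite /path_cost /gP /gA0 rep_mate mateK.
case: ifP => [tu ->|tu]; last first.
  move=> [e|[-> ->]] //; have := ncount_le2 u.
  have {e}-> : ncount N (mate u) = (2 - ncount N u)%N by lia.
  by case: (ncount N u) => [|[|[|]]].
by have [-> _ _] := gA_II tu.
Qed.

(** Halving the doubled bound settles the cycle edges and the paths. The remaining edges of value 1
    cost the same on both sides, and as their cost is nonnegative the factor 10/9 only helps. *)
Lemma mult_cost :
  \sum_u ((~~ N (u, true))%:R * c (hedge (u, true)) + (~~ N (u, false))%:R * c (hedge (u, false))
            + path_cost mate gP gA0 gA N u)
    <= \sum_u (5%:R / 9%:R * (c (hedge (u, true)) + c (hedge (u, false))) + 10%:R / 9%:R * gP u) ->
  cost c (fun e => (mult e)%:R) <= 10%:R / 9%:R * cost c x.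
Proof.
have -> : \sum_u ((~~ N (u, true))%:R * c (hedge (u, true)) +
      (~~ N (u, false))%:R * c (hedge (u, false)) + path_cost mate gP gA0 gA N u) =
    \sum_u (~~ N (u, true))%:R * c (hedge (u, true)) +
    \sum_u (~~ N (u, false))%:R * c (hedge (u, false)) +
    2%:R * \sum_(u | lead mate u) link_sum u (fun i => (lmult u i)%:R).
  rewrite !big_split /=; congr (_ + _); rewrite (big_involution _ _ mateK mateN) /= mulr_sumr.
  by apply: eq_bigr => u lu; rewrite path_cost_mate lead_path_cost // mulrDl mul1r.
have -> : \sum_u (5%:R / 9%:R * (c (hedge (u, true)) + c (hedge (u, false))) + 10%:R / 9%:R * gP u) =
    5%:R / 9%:R * (\sum_u c (hedge (u, true)) + \sum_u c (hedge (u, false))) +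
    10%:R / 9%:R * (2%:R * \sum_(u | lead mate u) link_sum u (fun=> 1)).
  rewrite big_split /= -!mulr_sumr big_split; congr (_ + _ * _).
  rewrite (big_involution _ _ mateK mateN) /= mulr_sumr.
  by apply: eq_bigr => u lu; rewrite /gP rep_mate /rep lu mulrDl mul1r.
move=> h.
rewrite /cost !edge_sum; last 2 first.
- by move=> e _ ->; rewrite mulr0.
- by move=> e /edgesP[u [v [_ ->]]] /mult0->; rewrite mulr0.
have -> : \sum_a c (hedge a) * (mult (hedge a))%:R = \sum_u ((~~ N (u, true))%:R * c (hedge (u, true)))
   + \sum_u ((~~ N (u, false))%:R * c (hedge (u, false))).
  rewrite big_dart -big_split /=; apply: eq_bigr => u _.
  by rewrite !mult_hedge ![c _ * _]mulrC.
have -> : \sum_a c (hedge a) * x (hedge a) =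
   (\sum_u c (hedge (u, true)) + \sum_u c (hedge (u, false))) / 2%:R.
  rewrite big_dart -big_split /= mulr_suml; apply: eq_bigr => u _ /=.
  have /andP[_ /eqP h1] := hedge_hlf (u, true); have /andP[_ /eqP h2] := hedge_hlf (u, false).
  by rewrite /hedge h1 h2 mulrDl !mul1r.
have -> : \sum_(u | lead mate u) \sum_(i < len u) c (ledge u i) * (mult (ledge u i))%:R =
   \sum_(u | lead mate u) link_sum u (fun i => (lmult u i)%:R).
  apply: eq_bigr => u lu; apply: eq_bigr => i _.
  by rewrite mult_ledge // mulrC.
have -> : \sum_(u | lead mate u) \sum_(i < len u) c (ledge u i) * x (ledge u i) =
   \sum_(u | lead mate u) link_sum u (fun=> 1).
  apply: eq_bigr => u lu; apply: eq_bigr => i _.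
  by have /andP[_ /eqP h1] := vtx_one (ltn_ord i); rewrite /ledge h1 mulrC.
have -> : \sum_(e in edges V | (x e == 1) && ~~ owned e) c e * (mult e)%:R =
   \sum_(e in edges V | (x e == 1) && ~~ owned e) c e.
  apply: eq_bigr => e /andP[eE /andP[/eqP x1 no]].
  by rewrite /mult eE x1 eq_sym (negPf half_neq1) eqxx (negPf no) mulr1.
have -> : \sum_(e in edges V | (x e == 1) && ~~ owned e) c e * x e =
   \sum_(e in edges V | (x e == 1) && ~~ owned e) c e.
  by apply: eq_bigr => e /andP[eE /andP[/eqP -> no]]; rewrite mulr1.
have : 0 <= \sum_(e in edges V | (x e == 1) && ~~ owned e) c e.
  by apply: sumr_ge0 => e /andP[eE _]; apply: hc.
move: h.
set a1 := \sum_u _; set a2 := \sum_u _; set a3 := \sum_u _; set a4 := \sum_u _.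
set a5 := \sum_(u | _) _; set a6 := \sum_(u | _) _; set a7 := \sum_(e in edges V | _) _.
lra.
Qed.

End Multiplicity.
End Links.

(** * Choice of the paths and of the cycle neighbours, and conclusion *)

Lemma G2M_of_F2M : (forall e, e \in edges V -> 0 <= c e) ->
  exists m : {set V} -> nat, G2M m /\ cost c (fun e => (m e)%:R) <= 10%:R / 9%:R * cost c x.
Proof.
move=> hc.
have exl (u : I) : exists l : seq V * V, [/\ uniq (val u :: rcons l.1 l.2),
   path one (val u) (rcons l.1 l.2) & half l.2].
  by have [_ [_ [_ _ _ _ [q [w h]]]]] := half_vertexP (valP u); exists (q, w).
have [lk lkP] := fin_all_exists exl.
have exn (u : I) : exists n : bool -> I, [/\ forall b, hlf (val u) (val (n b)), n true != n false
  & forall w, hlf (val u) w -> exists b, w = val (n b)].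
  have [a [b [ha hb ab h]]] := half_neighbours (valP u).
  exists (fun t => if t then Sub a (hlf_halfr ha) else Sub b (hlf_halfr hb)); split.
  - by case; rewrite SubK.
  - by rewrite -(inj_eq val_inj) !SubK.
  - by move=> w /h[->|->]; [exists true | exists false]; rewrite SubK.
have [nb nbP] := fin_all_exists exn.
have [N [N_ext N_st N_le]] := gadget_links lkP nbP hc.
exists (mult lk nb N); split; first exact: mult_G2M.
exact: mult_cost.
Qed.

End Structure.

Theorem theorem5 (R : realType) (V : finType) (hV : (3 <= #|V|)%N)
    (c : {set V} -> R) (hc : forall e, e \in edges V -> 0 <= c e)
    (x : {set V} -> R) (hx : F2M c x) (hcut : forall e, ~ cut_edge x e) :
  exists m : {set V} -> nat,
    G2M m /\ cost c (fun e => (m e)%:R) <= 10 / 9 * cost c x.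
Proof. exact: G2M_of_F2M hx hcut hc. Qed.
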